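(* In the Normal Gibbs sampler setting described in the context: (i) For given $K\ge0$, let $$A:=\frac{(\alpha+\frac J2)(|\bar Y|\sqrt K+1)(|\bar Y|\sqrt K+\frac12)}{\Sigma_0^2},\qquad r_1:=\frac{(|\bar Y|\sqrt K+1)(|\bar Y|\sqrt K+\frac12)}{\alpha+\frac J2-1}.$$ If $r_1<1$, then for any $\epsilon>0$ such that $r_{1,\epsilon}:=r_1+\epsilon A<1$, the function $\phi_{1,\epsilon}(x):=\frac1\epsilon\max\bigl(\epsilon,\frac1{x^2}\bigr)$ is a drift function with rate $r_{1,\epsilon}$. (ii) Assume $K=1$. Let $r_2:=(\alpha+\frac J2)\frac{J^2}{\Sigma_0^2}(|\bar Y|+1)(|\bar Y|+\frac12)$. If $r_2<1$, then $\phi_2(x)=1$ is a drift function with rate $r_2$. (iii) Assume $K=1$. Define $$\hat A:=\frac{(|\bar Y|+1)(\alpha+\frac J2)J\sqrt{2\pi}}{2\Sigma_0^2},\qquad b(x):=\frac J{\sqrt{2\pi}}\Bigl(\frac{2|\bar Y|}{(xJ+1)^{3/2}}+\frac1{xJ+1}\Bigr),$$ $$r_3:=\frac1{\sqrt{2\pi}}\left(4|\bar Y|\Bigl(1-\frac1{\sqrt{J(\alpha+J/2)/\Sigma_0+1}}\Bigr)+\log\Bigl(\frac{J(\alpha+J/2)}{\Sigma_0}+1\Bigr)\right).$$ If $r_3<1$, then for any $\epsilon>0$ such that $r_{3,\epsilon}:=r_3+\epsilon\hat A<1$, the function $\phi_{3,\epsilon}(x)=\frac1\epsilon\max(\epsilon,b(x))$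 is a drift function with rate $r_{3,\epsilon}$.
   Context: Normal Gibbs sampler. Fix an integer $J\ge1$, real numbers $Y_1,\dots,Y_J$, and parameters $\alpha>0$, $\beta\ge0$, $K\ge0$. Put $\bar Y=\frac1J\sum_jY_j$ and $\Sigma_0=\beta+\frac12\sum_j(Y_j-\bar Y)^2$, assumed $>0$. Let $Z\sim N(0,1)$ and $G\sim\Gamma(\alpha+J/2,1)$ (density $g^{\alpha+J/2-1}e^{-g}/\Gamma(\alpha+J/2)$ on $(0,\infty)$) be independent, and define the random function $f:(0,\infty)\to(0,\infty)$, $$f(s)=\frac{G}{\Sigma_0+\frac J2\Bigl(\frac{Z}{\sqrt{sJ+K}}-\frac{\bar YK}{sJ+K}\Bigr)^2}.$$ Let $f_1,f_2,\dots$ be i.i.d. copies of $f$ and $F_n=f_1\circ f_2\circ\cdots\circ f_n$. For a map $g:(0,\infty)\to(0,\infty)$ put $D_xg=\limsup_{y\to x}\frac{|g(x)-g(y)|}{|x-y|}$. A function $\phi:(0,\infty)\to[1,\infty)$ is a drift function with rate $r\in(0,1)$ if $E[D_xF_n]\le\phi(x)r^n$ for all $x>0$ and all $n\ge1$.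
   Formalization: Part (i) is stated under the added hypothesis α+J/2 > 1: for α+J/2 = 1 the number r_1 is undefined, and for α+J/2 < 1 it is negative, so small ε give r_{1,ε} ≤ 0, which is not a rate in (0,1). *)

(* Defs.v *)
From mathcomp Require Export all_boot all_order all_algebra.
From mathcomp Require Export all_classical all_reals all_analysis.
Export Order.TTheory GRing.Theory Num.Theory.
Export numFieldNormedType.Exports.

Set Implicit Arguments.
Unset Strict Implicit.
Unset Printing Implicit Defensive.

Local Open Scope classical_set_scope.
Local Open Scope ring_scope.

Definition Gamma_fun (R : realType) (a : R) : R :=
  (\int[lebesgue_measure]_(t in `]0%R, +oo[) (t `^ (a - 1) * expR (- t)))%R.

Definition gamma_pdf (R : realType) (a x : R) : R :=
  if 0 < x then x `^ (a - 1) * expR (- x) / Gamma_fun a else 0.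

(* The Gamma law with shape [a] and scale 1, defined by its density in the same
   way as [normal_prob]. *)
Definition gamma_prob (R : realType) (a : R) : set R -> \bar R :=
  fun V => (\int[lebesgue_measure]_(x in V) (gamma_pdf a x)%:E)%E.

Definition independent_rv2 (d d1 d2 : measure_display) (R : realType)
    (T : measurableType d) (T1 : measurableType d1) (T2 : measurableType d2)
    (P : probability T R) (X : T -> T1) (Y : T -> T2) : Prop :=
  forall (A : set T1) (B : set T2), measurable A -> measurable B ->
    P (X @^-1` A `&` Y @^-1` B) = (P (X @^-1` A) * P (Y @^-1` B))%E.

(* Mutual independence: the product rule over every finite set of indices. *)
Definition independent_seq (d d' : measure_display) (R : realType)
    (T : measurableType d) (T' : measurableType d')
    (P : probability T R) (X : nat -> T -> T') : Prop :=
  forall (s : seq nat) (A : nat -> set T'), uniq s ->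
    (forall i, measurable (A i)) ->
    P (\bigcap_(i in [set` s]) (X i @^-1` A i)) =
    (\prod_(i <- s) P (X i @^-1` A i))%E.

(* Maps of (0, +oo) are represented by functions R -> R. For x > 0 the limsup,
   taken over punctured neighborhoods of x, does not depend on the values
   outside (0, +oo). *)
Definition local_lip (R : realType) (g : R -> R) (x : R) : \bar R :=
  lime_sup (fun y => (`|g x - g y| / `|x - y|)%:E) x.

(* [iter_comp f n] is the composition f 0 \o f 1 \o ... \o f n.-1; the i-th
   random map f_i, for i >= 1, is [f i.-1]. *)
Fixpoint iter_comp (A : Type) (f : nat -> A -> A) (n : nat) : A -> A :=
  if n is m.+1 then iter_comp f m \o f m else id.

Definition drift_function (d : measure_display) (R : realType)
    (T : measurableType d) (P : probability T R) (f : nat -> T -> R -> R)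
    (phi : R -> R) (r : R) : Prop :=
  [/\ 0 < r < 1,
      (forall x, 0 < x -> 1 <= phi x) &
      forall (x : R) (n : nat), 0 < x -> (1 <= n)%N ->
        (\int[P]_w local_lip (iter_comp (fun i => f i w) n) x <=
         (phi x * r ^+ n)%:E)%E].

Definition sample_mean (R : realType) (J : nat) (Y : 'I_J -> R) : R :=
  (\sum_(j < J) Y j) / J%:R.

Definition Sigma0 (R : realType) (J : nat) (Y : 'I_J -> R) (beta : R) : R :=
  beta + (\sum_(j < J) (Y j - sample_mean Y) ^+ 2) / 2.

Definition gibbs_map (R : realType) (J : nat) (Y : 'I_J -> R) (beta K z g : R)
    (s : R) : R :=
  g / (Sigma0 Y beta + J%:R / 2 *
        (z / Num.sqrt (s * J%:R + K) -
         sample_mean Y * K / (s * J%:R + K)) ^+ 2).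

(* Main.v *)
From HB Require Import structures.
Require Import Defs.
From mathcomp Require Import measurable_realfun ring lra.
Set Implicit Arguments.
Unset Strict Implicit.
Unset Printing Implicit Defensive.
Local Open Scope classical_set_scope.
Local Open Scope ring_scope.
Import HBNNSimple.

(** Write t = sJ + K and S0 for [Sigma0 Y beta].  With
    u = Z / sqrt t - c K / t, where c is the sample mean, the random map is
    f(s) = G / (S0 + (J/2) u^2), and u'(s) = J v with
    v = c K / t^2 - Z / (2 t sqrt t), so that
    |f'(s)| = G J^2 |u| |v| / (S0 + (J/2) u^2)^2.

    Everything rests on a one-step inequality: phi is a drift function with
    rate r as soon as phi >= 1 and E[|f'(x)| phi(f(x))] <= r phi(x) for all
    x > 0.  Indeed F_n is almost surely differentiable on the half-line, so the
    local Lipschitz constant is a product of derivatives along the trajectory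
    started at x, by the chain rule.  Run the trajectory forward (f_n acts
    first) and keep track of the pair (current position y, product L of the
    derivatives met so far).  This pair only depends on the noise already used,
    so the next noise is independent of it, and integrating over the next
    noise alone replaces L |f'(y)| phi(f(y)) by at most r L phi(y)
    ([drift_iterate]).

    The one-step inequalities come from two estimates.

    - For every k >= |c| K / sqrt t one has
      |u| |v| <= (|Z| + k)(|Z|/2 + k) / t^2, whose expectation is at most
      (k + 1)(k + 1/2) / t^2 because E[Z^2] <= 1.  Dropping (J/2) u^2 from the
      denominator bounds E|f'|; dividing by f^2 cancels that denominator and
      gives E[|f'| / f^2].  With E[G] <= a and E[1/G] <= 1/(a - 1) this yields
      parts (i) and (ii), and the term A-hat of part (iii).

    - For part (iii), where K = 1, the derivatives of f in s and in Z are in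
      the ratio J sqrt t |v|, and this ratio times the Gaussian density is at
      most b(s)/2.  Hence, for fixed G, E[|f'| b(f)] is at most b(s)/2 times
      the total variation in Z of B(f), where B is the primitive of b with
      B(0) = 0.  As a function of Z, f increases up to its maximum G / S0 and
      then decreases, so this total variation is at most 2 B(G / S0).  Finally
      B is concave, so E[B(G / S0)] <= B(a / S0) = r_3; this follows by
      integrating the tangent of B at a / S0. *)

(** * Measurability and integration against a density *)

Lemma measurable_inv (R : realType) : measurable_fun [set: R] (@GRing.inv R).
Proof.
have -> : @GRing.inv R = fun x => if x == 0 then 0 else x^-1.
  by apply/funext => x; case: eqP => // ->; rewrite invr0.
have m0 : measurable_fun [set: R] (fun x : R => x == 0).
  by apply: (measurable_fun_bool true); rewrite setTI
    (_ : _ @^-1` _ = [set 0])//; apply/seteqP; split=> x /= /eqP.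
apply: measurable_fun_if => //.
apply: (@measurable_funS _ _ _ _ [set x : R | x != 0]).
- rewrite (_ : [set x | _] = ~` [set 0]); first exact: measurableC.
  by apply/seteqP; split=> x /= /eqP.
- by move=> x [_ /= ->].
- apply: open_continuous_measurable_fun; first exact: open_neq.
  by move=> x; rewrite inE => /= x0; exact: inv_continuous.
Qed.

Lemma measurable_sqrt (R : realType) : measurable_fun [set: R] (@Num.sqrt R).
Proof. apply: continuous_measurable_fun; exact: sqrt_continuous. Qed.

(** The integral of a nonnegative function is a supremum over the simple
    functions below it, so monotonicity only needs the larger function to be
    measurable. This spares the question whether the local Lipschitz constant
    of F_n is measurable in the random parameter. *)
Lemma le_integral_upper (d : measure_display) (T : measurableType d)
    (R : realType) (mu : {measure set T -> \bar R}) (f g : T -> \bar R) :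
  (forall x, 0 <= f x)%E -> measurable_fun setT g ->
  (forall x, f x <= g x)%E ->
  (\int[mu]_x f x <= \int[mu]_x g x)%E.
Proof.
move=> f0 mg fg.
have g0 x : (0 <= g x)%E by exact: le_trans (f0 x) (fg x).
rewrite !ge0_integralTE//; apply: ge_ereal_sup => _ [h hf <-].
apply: ereal_sup_ubound; exists h => // x.
exact: le_trans (hf x) (fg x).
Qed.

(** The formula holds for simple functions by definition of [nu], and both
    sides are continuous along increasing sequences. *)
Lemma ge0_integral_density (d : measure_display) (T : measurableType d)
    (R : realType) (mu nu : {measure set T -> \bar R}) (p : T -> R)
    (f : T -> \bar R) :
  measurable_fun setT p -> (forall x, 0 <= p x) ->
  (forall A, measurable A -> nu A = \int[mu]_(x in A) (p x)%:E)%E ->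
  measurable_fun setT f -> (forall x, 0 <= f x)%E ->
  (\int[nu]_x f x = \int[mu]_x (f x * (p x)%:E))%E.
Proof.
move=> mp p0 nuE mf f0.
pose h := nnsfun_approx measurableT mf.
have cvgh x : (EFin \o h n) x @[n --> \oo] --> f x.
  exact: cvg_nnsfun_approx.
have ndh x : nondecreasing_seq (fun n => (EFin \o h n) x).
  by move=> m n mn; rewrite lee_fin; exact/lefP/nd_nnsfun_approx.
have -> : (\int[nu]_x f x = limn (fun n => \int[nu]_x (EFin \o h n) x))%E.
  rewrite -monotone_convergence//.
  - by apply: eq_integral => x _; apply/esym/cvg_lim => //; exact: cvgh.
  - by move=> n; exact/measurable_EFinP.
  - by move=> n x _; rewrite lee_fin fun_ge0.
have -> : (\int[mu]_x (f x * (p x)%:E) =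
    limn (fun n => \int[mu]_x ((EFin \o h n) x * (p x)%:E)))%E.
  rewrite -monotone_convergence//.
  - apply: eq_integral => x _; apply/esym/cvg_lim => //.
    by apply: cvgeZr => //; exact: cvgh.
  - by move=> n; apply: emeasurable_funM; exact/measurable_EFinP.
  - by move=> n x _; rewrite mule_ge0// lee_fin ?fun_ge0.
  - by move=> x _ m n mn; rewrite lee_wpmul2r ?lee_fin//; exact: ndh.
congr (limn _); apply/funext => n.
have indic0 y x : (0 <= (y * \1_(h n @^-1` [set y]) x)%:E)%E.
  exact: nnfun_muleindic_ge0.
have indicm y : measurable_fun setT
    (fun x => (y * \1_(h n @^-1` [set y]) x)%:E).
  by apply/measurable_EFinP; exact: measurable_funM.
have mpE : measurable_fun setT (EFin \o p) by exact/measurable_EFinP.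
transitivity (\int[nu]_x (\sum_(y \in range (h n))
    (y * \1_(h n @^-1` [set y]) x)%:E))%E.
  by apply: eq_integral => x _; rewrite /= fimfunE -fsumEFin.
rewrite ge0_integral_fsum//.
transitivity (\int[mu]_x (\sum_(y \in range (h n))
    (y * \1_(h n @^-1` [set y]) x)%:E * (p x)%:E))%E; last first.
  apply: eq_integral => x _; rewrite -ge0_mule_fsuml//.
  by rewrite fsumEFin// -fimfunE.
rewrite ge0_integral_fsum//; last 2 first.
- by move=> y; exact: emeasurable_funM.
- by move=> y x _; rewrite mule_ge0// lee_fin.
apply: eq_fsbigr => r /[!inE] -[x0 _ <-].
have hx0 : 0 <= h n x0 by [].
under eq_integral do rewrite EFinM.
under [RHS]eq_integral do rewrite EFinM -muleA.
rewrite !ge0_integralZl//.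
- rewrite integral_indic// setIT nuE//; congr (_ * _)%E.
  rewrite [LHS]integral_mkcond; apply: eq_integral => x _.
  by rewrite muleC epatch_indic.
- by apply: emeasurable_funM => //; exact/measurable_EFinP.
- by move=> x _; rewrite mule_ge0// lee_fin.
- exact/measurable_EFinP.
Qed.

(** * Independence and iteration of the one-step inequality *)

(** Both sides are finite measures of [D] that agree on rectangles. The event
    [E] collects constraints on the noise not used so far; carrying it through
    lets independence be propagated along the trajectory. *)
Lemma indep_pair_law (d dV dU : measure_display) (T : measurableType d)
    (V : measurableType dV) (U : measurableType dU) (R : realType)
    (P : probability T R) (S : {mfun T >-> V}) (X : {mfun T >-> U})
    (mu : probability U R) (E : set T) (D : set (V * U)) :
  measurable E -> measurable D ->
  (forall (B : set V) (A : set U), measurable B -> measurable A ->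
     P (S @^-1` B `&` (X @^-1` A `&` E)) =
     P (S @^-1` B) * (mu A * P E))%E ->
  P ((fun w => (S w, X w)) @^-1` D `&` E) =
  ((distribution P S \x mu) D * P E)%E.
Proof.
move=> mE mD indep.
have mSX : measurable_fun setT (fun w => (S w, X w)).
  by apply: measurable_fun_pair; exact: measurable_funPT.
pose m0 : {measure set (V * U) -> \bar R} :=
  pushforward (mrestr P mE) (fun w => (S w, X w)).
pose m' := m0 mSX.
have PE0 : 0 <= fine (P E) by exact: fine_ge0.
have PEE : (fine (P E))%:E = P E by rewrite fineK// fin_num_measure.
pose m1 : {finite_measure set V -> \bar R} :=
  mscale (NngNum PE0) (distribution P S).
have eq1 : (m1 \x mu)%E D = m' D.
  apply: product_measure_unique => // B A mB mA.
  rewrite /m' /m1 /m0 /= /pushforward /mrestr /mscale/= PEE.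
  rewrite (_ : _ @^-1` _ = S @^-1` B `&` X @^-1` A)//.
  by rewrite -setIA indep// muleA muleC muleA.
have eq2 : (m1 \x mu)%E D = ((distribution P S \x mu) D * P E)%E.
  rewrite /product_measure1 muleC -PEE ge0_integral_mscale//=.
  exact: measurable_fun_xsection.
by rewrite -eq2 eq1.
Qed.

Lemma indep_integral (d dV dU : measure_display) (T : measurableType d)
    (V : measurableType dV) (U : measurableType dU) (R : realType)
    (P : probability T R) (S : {mfun T >-> V}) (X : {mfun T >-> U})
    (mu : probability U R) (h : V * U -> \bar R) :
  (forall (B : set V) (A : set U), measurable B -> measurable A ->
     P (S @^-1` B `&` X @^-1` A) = P (S @^-1` B) * mu A)%E ->
  measurable_fun setT h -> (forall p, 0 <= h p)%E ->
  (\int[P]_w h (S w, X w) = \int[P]_w \int[mu]_u h (S w, u))%E.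
Proof.
move=> indep mh h0.
have mSX : measurable_fun setT (fun w => (S w, X w)).
  by apply: measurable_fun_pair; exact: measurable_funPT.
pose m0 : {measure set (V * U) -> \bar R} :=
  pushforward P (fun w => (S w, X w)).
have -> : (\int[P]_w h (S w, X w) = \int[m0 mSX]_p h p)%E.
  rewrite ge0_integral_pushforward//.
have -> : (\int[m0 mSX]_p h p = \int[distribution P S \x mu]_p h p)%E.
  apply: eq_measure_integral => D mD _.
  rewrite /m0 /= /pushforward.
  have := @indep_pair_law _ _ _ _ _ _ _ P S X mu setT D measurableT mD.
  rewrite probability_setT mule1 setIT; apply=> B A mB mA.
  by rewrite setIT mule1 indep.
rewrite fubini_tonelli1//; apply: (ge0_integral_distribution S).
- exact: measurable_fun_fubini_tonelli_F.
- by move=> y; exact: integral_ge0.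
Qed.

(** The product of the derivatives [dq] along the trajectory that starts at
    [y] and applies the maps of index n-1, n-2, ..., 0 in this order, as
    [iter_comp] does. *)
Fixpoint chain_deriv (U V : Type) (R : realType) (q dq : U -> R -> R)
    (X : nat -> V -> U) (n : nat) (w : V) (y : R) : R :=
  if n is m.+1 then chain_deriv q dq X m w (q (X m w) y) * dq (X m w) y
  else 1.

(** The events generated by the noise of index below [n], that is, by the
    noise still to be used once the maps of larger index have been applied. *)
Definition cylinder (T U : Type) (X : nat -> T -> U) (n : nat)
    (A : nat -> set U) : set T := \bigcap_(i in `I_n) (X i @^-1` A i).

Lemma cylinderS (T U : Type) (X : nat -> T -> U) (n : nat)
    (A : nat -> set U) :
  cylinder X n.+1 A = X n @^-1` A n `&` cylinder X n A.
Proof.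
apply/seteqP; split=> w /=.
  move=> H; split; first exact: H (ltnSn n).
  by move=> i /= ni; apply: H => /=; exact: ltnW.
move=> [H1 H2] i /=; rewrite ltnS leq_eqVlt => /orP[/eqP-> //|].
exact: H2.
Qed.

Lemma measurable_cylinder (d dU : measure_display) (T : measurableType d)
    (U : measurableType dU) (X : nat -> {mfun T >-> U}) (n : nat)
    (A : nat -> set U) :
  (forall i, measurable (A i)) -> measurable (cylinder X n A).
Proof.
move=> mA; elim: n => [|n IH].
  by rewrite /cylinder II0 bigcap_set0.
by rewrite cylinderS; apply: measurableI => //; exact: measurable_funPTI.
Qed.

Lemma cylinderS_prob (d dU : measure_display) (T : measurableType d)
    (U : measurableType dU) (R : realType) (P : probability T R)
    (X : nat -> {mfun T >-> U}) (n : nat) (A : nat -> set U) :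
  independent_seq P (fun i w => X i w) -> (forall i, measurable (A i)) ->
  P (cylinder X n.+1 A) = (P (X n @^-1` A n) * P (cylinder X n A))%E.
Proof.
move=> ind mA.
have cylE m : P (cylinder X m A) = (\prod_(i <- iota 0 m) P (X i @^-1` A i))%E.
  rewrite -ind ?iota_uniq//; congr (P _).
  rewrite /cylinder (_ : `I_m = [set` iota 0 m])//.
  by apply/seteqP; split=> i /=; rewrite mem_iota add0n.
rewrite !cylE -addn1 iotaD/= big_cat/= big_seq1 muleC add0n//.
Qed.

Section drift_iterate.
Context (d dU : measure_display) (T : measurableType d)
  (U : measurableType dU) (R : realType) (P : probability T R)
  (X : nat -> {mfun T >-> U}) (mu : probability U R)
  (q dq : U -> R -> R) (phi : R -> R) (r : R).
Hypotheses
  (indep : independent_seq P (fun i w => X i w))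
  (lawX : forall i A, measurable A -> P (X i @^-1` A) = mu A)
  (mq : measurable_fun setT (fun p : R * U => q p.2 p.1))
  (mdq : measurable_fun setT (fun p : R * U => dq p.2 p.1))
  (mphi : measurable_fun setT phi)
  (q_gt0 : forall u y, 0 < y -> 0 < q u y)
  (dq_ge0 : forall u y, 0 <= dq u y)
  (phi_ge1 : forall y, 0 < y -> 1 <= phi y)
  (r_ge0 : 0 <= r)
  (step : forall y, 0 < y ->
     (\int[mu]_u (dq u y * phi (q u y))%:E <= (r * phi y)%:E)%E).

Lemma measurable_drift_integrand :
  measurable_fun setT (fun p : R * U => dq p.2 p.1 * phi (q p.2 p.1)).
Proof. by apply: measurable_funM => //; exact: measurableT_comp. Qed.

(** The state [S] pairs the current position with the product of the
    derivatives collected so far. It is only assumed independent of the noise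
    of index below [n]; the pair obtained from [S] and the noise of index [n]
    is then independent of the noise of index below [n], which is what the
    induction needs. *)
Lemma drift_iterate_state (n : nat) (S : {mfun T >-> (R * R)%type}) :
  (forall w, 0 < (S w).1) -> (forall w, 0 <= (S w).2) ->
  (forall (B : set (R * R)) (A : nat -> set U), measurable B ->
     (forall i, measurable (A i)) ->
     P (S @^-1` B `&` cylinder X n A) =
     P (S @^-1` B) * P (cylinder X n A))%E ->
  (\int[P]_w (chain_deriv q dq X n w (S w).1 * (S w).2)%:E <=
   (r ^+ n)%:E * \int[P]_w ((S w).2 * phi (S w).1)%:E)%E.
Proof.
elim: n S => [|n IH] S S1 S2 indS.
  rewrite expr0 mul1e; apply: le_integral_upper => [w||w].
  - by rewrite mul1r lee_fin.
  - apply/measurable_EFinP; apply: measurable_funM.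
      by apply: measurableT_comp => //; exact: measurable_snd.
    apply: measurableT_comp => //.
    by apply: measurableT_comp => //; exact: measurable_fst.
  - by rewrite lee_fin mul1r ler_peMr// phi_ge1.
have mS1 : measurable_fun setT (fun w => (S w).1).
  by apply: measurableT_comp => //; exact: measurable_fst.
have mS2 : measurable_fun setT (fun w => (S w).2).
  by apply: measurableT_comp => //; exact: measurable_snd.
pose Phi (p : (R * R) * U) := (q p.2 p.1.1, p.1.2 * dq p.2 p.1.1).
have mpair : measurable_fun setT (fun p : R * R * U => (p.1.1, p.2)).
  apply: measurable_fun_pair => //.
  by apply: measurableT_comp => //; exact: measurable_fst.
have mPhi : measurable_fun setT Phi.
  apply: measurable_fun_pair.
    exact: (measurableT_comp mq mpair).
  apply: measurable_funM; last exact: (measurableT_comp mdq mpair).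
  by apply: measurableT_comp => //; exact: measurable_snd.
have mSX : measurable_fun setT (fun w => (S w, X n w)).
  by apply: measurable_fun_pair; exact: measurable_funPT.
have mS' : measurable_fun setT (fun w => Phi (S w, X n w)).
  exact: measurableT_comp mSX.
pose S' : {mfun T >-> (R * R)%type} := HB.pack (fun w => Phi (S w, X n w))
  (@isMeasurableFun.Build _ _ _ _ (fun w => Phi (S w, X n w)) mS').
have indSX (B : set (R * R)) A' (A : nat -> set U) : measurable B ->
    measurable A' -> (forall i, measurable (A i)) ->
    (P (S @^-1` B `&` (X n @^-1` A' `&` cylinder X n A)) =
     P (S @^-1` B) * (mu A' * P (cylinder X n A)))%E.
  move=> mB mA' mA.
  pose A1 i := if i == n then A' else A i.
  have mA1 i : measurable (A1 i) by rewrite /A1; case: ifP.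
  have cylE : cylinder X n A1 = cylinder X n A.
    by apply/seteqP; split=> w H i /= ni; have := H i ni;
      rewrite /= /A1 (ltn_eqF ni).
  have cylSE : cylinder X n.+1 A1 = X n @^-1` A' `&` cylinder X n A.
    by rewrite cylinderS cylE /A1 eqxx.
  rewrite -cylSE indS// cylinderS_prob//.
  by rewrite cylE -(lawX n)// /A1 eqxx.
have cylT : cylinder X n (fun=> setT) = setT.
  by apply/seteqP; split=> w //= _ i.
have indSX0 (B : set (R * R)) (A' : set U) : measurable B -> measurable A' ->
    (P (S @^-1` B `&` X n @^-1` A') = P (S @^-1` B) * mu A')%E.
  move=> mB mA'; have := @indSX B A' (fun=> setT) mB mA' (fun=> measurableT).
  by rewrite cylT setIT probability_setT mule1.
have le1 : (\int[P]_w (chain_deriv q dq X n.+1 w (S w).1 * (S w).2)%:E <=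
    (r ^+ n)%:E * \int[P]_w ((S' w).2 * phi (S' w).1)%:E)%E.
  rewrite (eq_integral (fun w =>
      (chain_deriv q dq X n w (S' w).1 * (S' w).2)%:E)); last first.
    by move=> w _; rewrite /S'/=; congr (_%:E); ring.
  apply: IH => [w|w|B A mB mA].
  - by rewrite /=; apply: q_gt0; exact: S1.
  - by rewrite /= mulr_ge0.
  have mPB : measurable (Phi @^-1` B).
    by rewrite -[X in measurable X]setTI; exact: mPhi.
  have := @indep_pair_law _ _ _ _ _ _ _ P S (X n) mu _ _
    (measurable_cylinder X n mA) mPB.
  have := @indep_pair_law _ _ _ _ _ _ _ P S (X n) mu _ _
    measurableT mPB.
  rewrite !setIT probability_setT mule1.
  rewrite (_ : _ @^-1` (Phi @^-1` B) = S' @^-1` B)// => -> //; last first.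
    by move=> B' A' mB' mA'; rewrite setIT mule1 indSX0.
  by move=> ->// B' A' mB' mA'; rewrite indSX.
apply: (le_trans le1).
rewrite exprS mulrC EFinM -muleA.
apply: lee_wpmul2l; first by rewrite lee_fin exprn_ge0.
(* [h] may be negative off the half-line, where the trajectory never goes; the
   maximum with 0 below makes Tonelli's theorem applicable. *)
pose h (p : (R * R) * U) := (p.1.2 * (dq p.2 p.1.1 * phi (q p.2 p.1.1)))%:E.
have mh : measurable_fun setT h.
  apply/measurable_EFinP; apply: measurable_funM.
    by apply: measurableT_comp => //; exact: measurable_fst.
  exact: (measurableT_comp measurable_drift_integrand mpair).
have h_ge0 p : 0 <= p.1.2 -> 0 < p.1.1 -> (0 <= h p)%E.
  move=> p0 p1; rewrite lee_fin !mulr_ge0// ltW// (lt_le_trans ltr01)//.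
  exact/phi_ge1/q_gt0.
have -> : (\int[P]_w ((S' w).2 * phi (S' w).1)%:E =
    \int[P]_w maxe 0%E (h (S w, X n w)))%E.
  apply: eq_integral => w _; rewrite max_r ?h_ge0//=.
  by rewrite /h/= mulrA.
rewrite (@indep_integral _ _ _ _ _ _ _ P S (X n) mu
    (fun p => maxe 0%E (h p)))//; last 2 first.
- exact: measurable_maxe.
- by move=> p; rewrite le_max lexx.
rewrite -ge0_integralZl//; last 2 first.
- apply/measurable_EFinP/measurable_funM => //.
  exact: measurableT_comp.
- by move=> w _; rewrite lee_fin mulr_ge0// ltW// (lt_le_trans ltr01)// phi_ge1.
apply: le_integral_upper => [w||w].
- by apply: integral_ge0 => u _; rewrite le_max lexx.
- apply/measurable_EFinP/measurable_funM => //; apply: measurable_funM => //.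
  exact: measurableT_comp.
rewrite (eq_integral (fun u => (S w).2%:E *
    (dq u (S w).1 * phi (q u (S w).1))%:E)%E); last first.
  by move=> u _; rewrite max_r ?h_ge0//= /h EFinM.
rewrite ge0_integralZl//; last 3 first.
- apply/measurable_EFinP.
  exact: (measurableT_comp measurable_drift_integrand (measurable_pair1 _)).
- move=> u _; rewrite lee_fin mulr_ge0// ltW// (lt_le_trans ltr01)//.
  exact/phi_ge1/q_gt0.
- by rewrite lee_fin.
rewrite -EFinM mulrCA EFinM; apply: lee_wpmul2l; first by rewrite lee_fin.
exact: step.
Qed.

Lemma drift_iterate (n : nat) (x : R) : 0 < x ->
  (\int[P]_w (chain_deriv q dq X n w x)%:E <= (phi x * r ^+ n)%:E)%E.
Proof.
move=> x0.
pose S : {mfun T >-> (R * R)%type} := cst (x, 1).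
have := @drift_iterate_state n S (fun=> x0) (fun=> ler01).
rewrite /S/= mul1r integral_cst//.
rewrite [X in (_ * (_ * X))%E](_ : _ = 1%E); last exact: probability_setT.
rewrite mule1 -EFinM mulrC.
under eq_integral do rewrite mulr1.
apply=> B A mB mA; rewrite preimage_cst; case: ifP => _.
  by rewrite setTI probability_setT mul1e.
by rewrite set0I measure0 mul0e.
Qed.

Lemma measurable_chain_deriv (n : nat) (y : T -> R) : measurable_fun setT y ->
  measurable_fun setT (fun w => chain_deriv q dq X n w (y w)).
Proof.
elim: n y => [|n IH] y my; first exact: measurable_cst.
have myX : measurable_fun setT (fun w => (y w, X n w)).
  by apply: measurable_fun_pair => //; exact: measurable_funPT.
apply: measurable_funM; last exact: (measurableT_comp mdq myX).
by apply: IH; exact: (measurableT_comp mq myX).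
Qed.
End drift_iterate.

(** * Derivatives and the fundamental theorem of calculus *)

Section pointwise_derivatives.
Context (R : realType).
Implicit Types (f g : R -> R) (x df dg : R).

(** The differentiation rules are put in a form where functions are explicit
    abstractions and derivatives ordinary products: they then compose by plain
    application, and the resulting value is compared with the expected one by
    a field computation. *)
Lemma is_derive_mul f g x df dg : is_derive x 1 f df -> is_derive x 1 g dg ->
  is_derive x 1 (fun y => f y * g y) (df * g x + f x * dg).
Proof.
move=> hf hg; have h := is_deriveM hf hg; apply: (is_derive_eq h).
by rewrite addrC mulrC.
Qed.

Lemma is_derive_add f g x df dg : is_derive x 1 f df -> is_derive x 1 g dg ->
  is_derive x 1 (fun y => f y + g y) (df + dg).
Proof. by move=> hf hg; exact: (is_deriveD hf hg). Qed.

Lemma is_derive_sub f g x df dg : is_derive x 1 f df -> is_derive x 1 g dg ->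
  is_derive x 1 (fun y => f y - g y) (df - dg).
Proof. by move=> hf hg; exact: (is_deriveB hf hg). Qed.

Lemma is_derive_opp f x df : is_derive x 1 f df ->
  is_derive x 1 (fun y => - f y) (- df).
Proof. by move=> hf; exact: (is_deriveN hf). Qed.

Lemma is_derive_const (c : R) x : is_derive x 1 (fun=> c) 0.
Proof. exact: is_derive_cst. Qed.

Lemma is_derive_var x : is_derive x 1 (fun y : R => y) 1.
Proof. exact: is_derive_id. Qed.

Lemma is_derive_sqr f x df : is_derive x 1 f df ->
  is_derive x 1 (fun y => f y ^+ 2) (2 * f x * df).
Proof.
move=> hf; rewrite (_ : (fun y => _) = (fun y => f y * f y)).
  by have h := is_derive_mul hf hf; apply: (is_derive_eq h); ring.
by apply/funext => y; rewrite expr2.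
Qed.

Lemma is_derive_inv f x df : is_derive x 1 f df -> f x != 0 ->
  is_derive x 1 (fun y => (f y)^-1) (- df / f x ^+ 2).
Proof.
move=> hf fx; have h := is_deriveV fx hf; apply: (is_derive_eq h).
by rewrite /GRing.scale/=; ring.
Qed.

Lemma is_derive_chain (h : R -> R) f x dh df :
  is_derive x 1 f df -> is_derive (f x) 1 h dh ->
  is_derive x 1 (fun y => h (f y)) (dh * df).
Proof. by move=> hf hh; exact: (is_derive1_comp hh hf). Qed.

Lemma is_derive_continuous f x df : is_derive x 1 f df ->
  {for x, continuous f}.
Proof.
by move=> hf; apply/differentiable_continuous/derivable1_diffP;
  exact: (@ex_derive _ _ _ _ _ _ _ hf).
Qed.

Lemma integral_is_derive (F f : R -> R) (a b : R) : a < b ->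
  (forall x, a <= x <= b -> is_derive x 1 F (f x)) ->
  (forall x, a <= x <= b -> {for x, continuous f}) ->
  (\int[lebesgue_measure]_(x in `[a, b]) (f x)%:E = (F b - F a)%:E)%E.
Proof.
move=> ab dF cf; rewrite EFinB; apply: continuous_FTC2 => //.
- apply: continuous_in_subspaceT => x /[!inE]/=.
  by rewrite in_itv/= => /cf.
- have cF x : a <= x <= b -> {for x, continuous F}.
    by move=> /dF; exact: is_derive_continuous.
  split.
  + move=> x; rewrite in_itv/= => /andP[ax xb].
    have hx : is_derive x 1 F (f x) by apply: dF; rewrite !ltW.
    exact: (@ex_derive _ _ _ _ _ _ _ hx).
  + by apply: cvg_at_right_filter; apply: cF; rewrite lexx ltW.
  + by apply: cvg_at_left_filter; apply: cF; rewrite lexx ltW.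
- move=> x; rewrite in_itv/= => /andP[ax xb].
  have hx : is_derive x 1 F (f x) by apply: dF; rewrite !ltW.
  by rewrite derive1E derive_val.
Qed.

(** Integration by parts for F = - z p(z) or F = x^s e^-x: the derivative of
    such a product is a difference [f - g] of two functions of constant sign.
    *)
Lemma integral_add_is_derive (F f g : R -> R) (a b : R) : a < b ->
  (forall x, a <= x <= b -> is_derive x 1 F (f x - g x)) ->
  (forall x, a <= x <= b -> {for x, continuous f}) ->
  (forall x, a <= x <= b -> {for x, continuous g}) ->
  (\int[lebesgue_measure]_(x in `[a, b]) (f x)%:E =
   \int[lebesgue_measure]_(x in `[a, b]) (g x)%:E + (F b - F a)%:E)%E.
Proof.
move=> ab dF cf cg.
have cfg x : a <= x <= b -> {for x, continuous (fun x => f x - g x)}.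
  by move=> xab; apply: continuousB; [exact: cf|exact: cg].
rewrite -(integral_is_derive ab dF cfg) -integralD//=.
- by apply: eq_integral => x _; rewrite -EFinD addrC subrK.
- apply: continuous_compact_integrable; first exact: segment_compact.
  apply: continuous_in_subspaceT => x /[!inE]/=.
  by rewrite in_itv/= => /cg.
- apply: continuous_compact_integrable; first exact: segment_compact.
  apply: continuous_in_subspaceT => x /[!inE]/=.
  by rewrite in_itv/= => /cfg.
Qed.

(** The error term [e] absorbs the boundary values left by an integration by
    parts on the bounded intervals. *)
Lemma integral_le_exhaustion (I : nat -> set R) (f : R -> R) (C : R)
    (e : nat -> R) :
  nondecreasing_seq I -> (forall n, measurable (I n)) ->
  measurable_fun (\bigcup_n I n) f ->
  (forall n x, I n x -> 0 <= f x) ->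
  (forall n, \int[lebesgue_measure]_(x in I n) (f x)%:E <= (C + e n)%:E)%E ->
  e @ \oo --> 0 ->
  (\int[lebesgue_measure]_(x in \bigcup_n I n) (f x)%:E <= C%:E)%E.
Proof.
move=> ndI mI mf f0 fC e0.
have cvgI : (\int[lebesgue_measure]_(x in I n) (f x)%:E @[n --> \oo] -->
    \int[lebesgue_measure]_(x in \bigcup_n I n) (f x)%:E)%E.
  apply: ge0_nondecreasing_set_cvg_integral => //.
    move=> n; apply/measurable_EFinP.
    apply: measurable_funS mf; first exact: bigcup_measurable.
    exact: bigcup_sup.
have cvgC : (C + e n)%:E @[n --> \oo] --> C%:E.
  apply: cvg_EFin; first exact: nearW.
  by rewrite -[X in _ --> X]addr0; apply: cvgD => //; exact: cvg_cst.
rewrite -(cvg_lim _ cvgI)// -(cvg_lim _ cvgC)//.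
apply: lee_lim.
- by apply/cvg_ex; eexists; exact: cvgI.
- by apply/cvg_ex; eexists; exact: cvgC.
- by apply: nearW => n; exact: fC.
Qed.
End pointwise_derivatives.

(** * Second moment of the normal density and unimodal functions *)

Lemma std_normal_pdfE (R : realType) (z : R) :
  normal_pdf 0 1 z = (Num.sqrt (2 * pi))^-1 * expR (- (z ^+ 2 / 2)).
Proof.
rewrite normal_pdfE ?oner_eq0//= /normal_peak /normal_fun.
by rewrite expr1n mul1r subr0 -mulr_natl mulNr.
Qed.

Lemma is_derive_std_normal_pdf (R : realType) (z : R) :
  is_derive z 1 (normal_pdf 0 1) (- z * normal_pdf 0 1 z).
Proof.
rewrite (_ : normal_pdf 0 1 = fun z : R =>
    (Num.sqrt (2 * pi))^-1 * expR (- (z ^+ 2 * 2^-1))); last first.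
  by apply/funext => y; rewrite std_normal_pdfE.
have h1 := is_derive_opp (is_derive_mul (is_derive_sqr (is_derive_var z))
  (is_derive_const 2^-1 z)).
have h2 := is_derive_chain h1 (is_derive_expR _).
have h3 := is_derive_mul (is_derive_const (Num.sqrt (2 * pi))^-1 z) h2.
apply: (is_derive_eq h3) => /=.
by move: (Num.sqrt (2 * pi))^-1 => c; field.
Qed.

(** The derivative of - z p(z) is (z^2 - 1) p(z), and its boundary values on
    [-n, n] are nonpositive. *)
Lemma std_normal_second_moment (R : realType) :
  (\int[lebesgue_measure]_z (z ^+ 2 * normal_pdf 0 1 z : R)%:E <= 1)%E.
Proof.
pose I n : set R := `[(- n.+1%:R)%R, n.+1%:R]%classic.
have cp z : {for z, continuous (normal_pdf 0 1 : R -> R)}.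
  exact: is_derive_continuous (is_derive_std_normal_pdf z).
have cf z : {for z, continuous (fun z : R => z ^+ 2 * normal_pdf 0 1 z)}.
  exact: is_derive_continuous (is_derive_mul (is_derive_sqr (is_derive_var z))
    (is_derive_std_normal_pdf z)).
have IT : \bigcup_n I n = setT.
  apply/seteqP; split=> // x _.
  exists (Num.truncn `|x|) => //=.
  by rewrite /I/= in_itv/= -ler_norml ltW// truncnS_gt.
rewrite -[X in integral _ X]IT.
apply: (@integral_le_exhaustion _ _ _ _ (fun=> 0)).
- move=> m n mn; rewrite subsetEset; apply: subset_itv.
    by rewrite bnd_simp lerN2 ler_nat.
  by rewrite bnd_simp ler_nat.
- by move=> n; exact: measurable_itv.
- by rewrite IT; apply: continuous_measurable_fun => z; exact: cf.
- by move=> n x _; rewrite mulr_ge0 ?sqr_ge0 ?normal_pdf_ge0.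
- move=> n.
  have nn : - n.+1%:R < n.+1%:R :> R by rewrite (@lt_trans _ _ 0)// oppr_lt0.
  have dF (z : R) : - n.+1%:R <= z <= n.+1%:R ->
      is_derive z 1 (fun z => - (z * normal_pdf 0 1 z))
        (z ^+ 2 * normal_pdf 0 1 z - normal_pdf 0 1 z).
    have h := is_derive_opp (is_derive_mul (is_derive_var z)
      (is_derive_std_normal_pdf z)).
    by move=> _; apply: (is_derive_eq h); ring.
  rewrite (integral_add_is_derive nn dF)//.
  rewrite [leRHS]EFinD; apply: leeD.
    rewrite -(integral_normal_pdf 0 1); apply: ge0_subset_integral => //.
    - by apply/measurable_EFinP; exact: measurable_normal_pdf.
    - by move=> x _; rewrite lee_fin normal_pdf_ge0.
  rewrite lee_fin.
  have p1 := normal_pdf_ge0 0 1 (n.+1%:R : R).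
  have p2 := normal_pdf_ge0 0 1 (- n.+1%:R : R).
  by rewrite mulNr opprK -opprD oppr_le0 addr_ge0// mulr_ge0.
- exact: cvg_cst.
Qed.

(** The total variation of a nonnegative function that increases up to [z0]
    and then decreases is at most twice its maximum. *)
Lemma unimodal_variation (R : realType) (F f : R -> R) (z0 M : R) :
  (forall z : R, is_derive z 1 F (f z)) -> continuous f ->
  (forall z, z <= z0 -> 0 <= f z) -> (forall z, z0 <= z -> f z <= 0) ->
  (forall z, 0 <= F z) -> F z0 <= M ->
  (\int[lebesgue_measure]_z `|f z|%:E <= (2 * M)%:E)%E.
Proof.
move=> dF cf fl fr F0 FM.
have mf : measurable_fun setT (fun z => `|f z|).
  by apply: measurableT_comp => //; exact: continuous_measurable_fun.
have mfE (D : set R) : measurable D ->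
    measurable_fun D (fun z => `|f z|%:E).
  by move=> mD; apply/measurable_EFinP; exact: measurable_funS mf.
pose Il n : set R := `](z0 - n.+1%:R)%R, z0]%classic.
pose Ir n : set R := `]z0, (z0 + n.+1%:R)%R]%classic.
have IlE : \bigcup_n Il n = `]-oo, z0]%classic.
  apply/seteqP; split=> x /=.
    by move=> [n _]; rewrite /Il /= !in_itv/= => /andP[].
  rewrite in_itv/= => xz; exists (Num.truncn `|z0 - x|) => //=.
  rewrite /Il/= in_itv/= xz andbT ltrBlDr addrC -ltrBlDr.
  by rewrite (le_lt_trans (ler_norm _))// truncnS_gt.
have IrE : \bigcup_n Ir n = `]z0, +oo[%classic.
  apply/seteqP; split=> x /=.
    by move=> [n _]; rewrite /Ir /= !in_itv/= andbT => /andP[].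
  rewrite in_itv/= andbT => xz; exists (Num.truncn `|x - z0|) => //=.
  rewrite /Ir/= in_itv/= xz/= addrC -lerBlDr.
  by rewrite (le_trans (ler_norm _))// ltW// truncnS_gt.
have -> : [set: R] = `]-oo, z0]%classic `|` `]z0, +oo[%classic.
  apply/seteqP; split=> x //= _; rewrite !in_itv/= andbT.
  by case: (lerP x z0); [left|right].
rewrite ge0_integral_setU//=; last 2 first.
- by apply: mfE; exact: measurableU.
- apply/disj_setPS => x /=; rewrite !in_itv/= andbT => -[xz zx].
  by rewrite ltNge xz in zx.
have ltl n : z0 - n.+1%:R < z0 by rewrite ltrBlDr ltrDl.
have ltr n : z0 < z0 + n.+1%:R by rewrite ltrDl.
rewrite mulr2n mulrDl !mul1r EFinD -IlE -IrE; apply: leeD.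
- apply: (@integral_le_exhaustion _ _ _ _ (fun=> 0)).
  + move=> m n mn; rewrite subsetEset; apply: subset_itvr.
    by rewrite bnd_simp lerD2l lerN2 ler_nat.
  + by move=> n; exact: measurable_itv.
  + exact: measurable_funS mf.
  + by [].
  + move=> n; rewrite addr0.
    apply: (@le_trans _ _ (\int[lebesgue_measure]_(z in
      `[(z0 - n.+1%:R)%R, z0]) (f z)%:E)%E); last first.
      rewrite (integral_is_derive (ltl n) (fun z _ => dF z))//.
        by rewrite lee_fin lerBlDr (le_trans FM)// lerDl.
      by move=> z _; exact: cf.
    have -> : (\int[lebesgue_measure]_(z in `[(z0 - n.+1%:R)%R, z0]) (f z)%:E =
        \int[lebesgue_measure]_(z in `[(z0 - n.+1%:R)%R, z0]) `|f z|%:E)%E.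
      apply: eq_integral => z; rewrite inE/= in_itv/= => /andP[_ zz0].
      by rewrite ger0_norm// fl.
    apply: ge0_subset_integral => //;
      [exact: measurable_itv|by apply: mfE; exact: measurable_itv|].
    by apply: subset_itvr; rewrite bnd_simp.
  + exact: cvg_cst.
- apply: (@integral_le_exhaustion _ _ _ _ (fun=> 0)).
  + move=> m n mn; rewrite subsetEset; apply: subset_itvl.
    by rewrite bnd_simp lerD2l ler_nat.
  + by move=> n; exact: measurable_itv.
  + exact: measurable_funS mf.
  + by [].
  + move=> n; rewrite addr0.
    apply: (@le_trans _ _ (\int[lebesgue_measure]_(z in
      `[z0, (z0 + n.+1%:R)%R]) (- f z)%:E)%E); last first.
      have dNF (z : R) : is_derive z 1 (fun z => - F z) (- f z).
        exact: is_derive_opp.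
      rewrite (integral_is_derive (ltr n) (fun z _ => dNF z))//.
      - by rewrite lee_fin opprK addrC lerBlDr (le_trans FM)// lerDl.
      - by move=> x _; apply: continuousN; exact: cf.
    have -> : (\int[lebesgue_measure]_(z in `[z0, (z0 + n.+1%:R)%R]) (- f z)%:E =
        \int[lebesgue_measure]_(z in `[z0, (z0 + n.+1%:R)%R]) `|f z|%:E)%E.
      apply: eq_integral => z; rewrite inE/= in_itv/= => /andP[zz0 _].
      by rewrite ler0_norm// fr.
    apply: ge0_subset_integral => //;
      [exact: measurable_itv|by apply: mfE; exact: measurable_itv|].
    by apply: subset_itvr; rewrite bnd_simp.
  + exact: cvg_cst.
Qed.

(** * Gamma integrals *)

(** The integrand of the Gamma function. *)
Definition gamma_kernel (R : realType) (s x : R) : R := x `^ (s - 1) * expR (- x).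

Section gamma_integrals.
Context (R : realType).
Implicit Types (s x : R).
Notation mu := lebesgue_measure.

Lemma gamma_kernel_ge0 s x : 0 <= gamma_kernel s x.
Proof. by rewrite mulr_ge0 ?powR_ge0 ?expR_ge0. Qed.

Lemma measurable_gamma_kernel s (D : set R) :
  measurable_fun D (gamma_kernel s).
Proof.
apply: measurable_funTS; apply: measurable_funM => //.
by apply: measurableT_comp => //; exact: measurable_funN.
Qed.

Lemma is_derive_gamma_kernel s x : 0 < x ->
  is_derive x 1 (gamma_kernel (s + 1)) (s * gamma_kernel s x - gamma_kernel (s + 1) x).
Proof.
move=> x0.
have h1 := is_derive1_powR (s + 1 - 1) x0.
have h2 := is_derive_chain (is_derive_opp (is_derive_var x)) (is_derive_expR _).
have h := is_derive_mul h1 h2.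
by apply: (is_derive_eq h); rewrite /gamma_kernel addrK; ring.
Qed.

Lemma continuous_gamma_kernel s x : 0 < x -> {for x, continuous (gamma_kernel s)}.
Proof.
move=> x0; have := @is_derive_gamma_kernel (s - 1) x x0.
by rewrite subrK; exact: is_derive_continuous.
Qed.

(** Compact intervals that avoid 0, where the kernel is singular for s < 1. *)
Definition exhaust n : set R := `[(n.+2%:R)^-1%R, n.+2%:R]%classic.

Lemma exhaustE : \bigcup_n exhaust n = `]0, +oo[%classic.
Proof.
apply/seteqP; split=> x /=.
  move=> [n _]; rewrite /exhaust/= !in_itv/= andbT => /andP[+ _].
  by apply: lt_le_trans; rewrite invr_gt0.
rewrite in_itv/= andbT => x0.
pose k := maxn (Num.truncn x) (Num.truncn x^-1).
have kx : x < k.+1%:R.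
  by rewrite (lt_le_trans (truncnS_gt x))// ler_nat ltnS leq_maxl.
have kV : x^-1 < k.+1%:R.
  by rewrite (lt_le_trans (truncnS_gt x^-1))// ler_nat ltnS leq_maxr.
have kk : k.+1%:R <= k.+2%:R :> R by rewrite ler_nat.
exists k => //; rewrite /exhaust/= in_itv/=; apply/andP; split.
  by rewrite -[leRHS]invrK lef_pV2 ?posrE ?invr_gt0// ltW// (lt_le_trans kV).
by rewrite ltW// (lt_le_trans kx).
Qed.

Lemma exhaust_nd : nondecreasing_seq exhaust.
Proof.
move=> m n mn; rewrite subsetEset; apply: subset_itv.
  by rewrite bnd_simp lef_pV2 ?posrE// ler_nat.
by rewrite bnd_simp ler_nat.
Qed.

Lemma exhaust_lt n : (n.+2%:R)^-1 < n.+2%:R :> R.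
Proof. by rewrite (@lt_trans _ _ 1)// ?invf_lt1// ltr1n. Qed.

Lemma exhaust_gt0 n x : (n.+2%:R)^-1 <= x <= n.+2%:R -> 0 < x.
Proof. by move=> /andP[+ _]; apply: lt_le_trans; rewrite invr_gt0. Qed.

Lemma cvg_exhaust_powR s : 0 < s -> (n.+2%:R^-1 : R) `^ s @[n --> \oo] --> 0.
Proof.
move=> s0; have /cvg_at_rightP := powR_cvg0 s0; apply; split=> [n|].
  by rewrite invr_gt0.
have := @cvg_harmonic R; rewrite -(cvg_shiftn 1); apply: cvg_trans.
by apply: near_eq_cvg; apply: nearW => n /=; rewrite /harmonic addn1.
Qed.

Lemma integral_exhaust_le s n :
  (\int[mu]_(x in exhaust n) (gamma_kernel s x)%:E <=
   \int[mu]_(x in `]0%R, +oo[) (gamma_kernel s x)%:E)%E.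
Proof.
apply: ge0_subset_integral.
- exact: measurable_itv.
- exact: measurable_itv.
- by apply/measurable_EFinP; apply: measurable_gamma_kernel.
- by move=> x _; rewrite lee_fin gamma_kernel_ge0.
- by rewrite -exhaustE => x xn; exists n.
Qed.

(** Together with [gamma_integral_pred_le], the two halves of Gamma(s + 1) = s
    Gamma(s), each obtained by integration by parts and stated as a bound so
    that no integrability is needed beforehand. *)
Lemma gamma_integralS_le s (C : R) : 0 < s ->
  (\int[mu]_(x in `]0%R, +oo[) (gamma_kernel s x)%:E <= C%:E)%E ->
  (\int[mu]_(x in `]0%R, +oo[) (gamma_kernel (s + 1) x)%:E <= (s * C)%:E)%E.
Proof.
move=> s0 hC; rewrite -exhaustE.
apply: (@integral_le_exhaustion _ _ _ _ (fun n => (n.+2%:R^-1 : R) `^ s)).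
- exact: exhaust_nd.
- by move=> n; exact: measurable_itv.
- exact: measurable_gamma_kernel.
- by move=> *; exact: gamma_kernel_ge0.
- move=> n.
  have dF x : (n.+2%:R)^-1 <= x <= n.+2%:R -> is_derive x 1
      (fun x => - gamma_kernel (s + 1) x)
      (gamma_kernel (s + 1) x - s * gamma_kernel s x).
    move=> /exhaust_gt0 x0.
    have h := is_derive_opp (is_derive_gamma_kernel s x0).
    by apply: (is_derive_eq h); rewrite opprB.
  rewrite /exhaust (integral_add_is_derive (exhaust_lt n) dF); last 2 first.
  + by move=> x /exhaust_gt0 x0; exact: continuous_gamma_kernel.
  + move=> x /exhaust_gt0 x0; apply: continuousM; first exact: cst_continuous.
    exact: continuous_gamma_kernel.
  rewrite [leRHS]EFinD; apply: leeD.
    under eq_integral do rewrite EFinM.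
    rewrite ge0_integralZl//=; last 3 first.
    + by apply/measurable_EFinP; apply: measurable_gamma_kernel.
    + by move=> x _; rewrite lee_fin gamma_kernel_ge0.
    + by rewrite lee_fin ltW.
    rewrite [leRHS]EFinM; apply: lee_wpmul2l; first by rewrite lee_fin ltW.
    apply: le_trans hC.
    exact: integral_exhaust_le.
  rewrite lee_fin opprK addrC lerBlDr.
  apply: (@le_trans _ _ (n.+2%:R^-1 `^ s)).
    rewrite /gamma_kernel addrK ler_piMr ?powR_ge0//.
  by rewrite lerDl gamma_kernel_ge0.
- exact: cvg_exhaust_powR.
Qed.

(** The bound e^y >= 1 + y >= y at y = x / (2s), raised to the power 2s, beats
    the factor x^s. *)
Lemma gamma_kernel_decay s x : 0 < s -> 0 < x ->
  gamma_kernel (s + 1) x <= (2 * s) `^ (2 * s) * x^-1 `^ s.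
Proof.
move=> s0 x0; rewrite /gamma_kernel addrK.
have s20 : 0 < 2 * s by rewrite mulr_gt0.
have h : (x / (2 * s)) `^ (2 * s) <= expR x.
  have e1 : x / (2 * s) <= expR (x / (2 * s)).
    by rewrite (le_trans _ (expR_ge1Dx _))// lerDr.
  have -> : expR x = expR (x / (2 * s)) `^ (2 * s).
    by rewrite -expRM divfK ?gt_eqF.
  apply: ge0_ler_powR => //; rewrite ?nnegrE ?expR_ge0 ?ltW//.
  by rewrite divr_gt0.
(* The exponent 2s leaves a factor x^-s after division by x^2s. *)
have p0 : 0 < x `^ s by exact: powR_gt0.
have q0 : 0 < (2 * s) `^ (2 * s) by exact: powR_gt0.
have xV : x^-1 `^ s = (x `^ s)^-1.
  by rewrite -powR_inv1 ?ltW// -powRrM mulN1r powRN.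
have xx : x `^ (2 * s) = x `^ s * x `^ s.
  by rewrite mulr_natl mulr2n powRD// (gt_eqF x0) implybT.
have h2 : x `^ s * x `^ s <= expR x * (2 * s) `^ (2 * s).
  have V0 : 0 <= (2 * s)^-1 by rewrite invr_ge0 ltW.
  move: h; rewrite (powRM _ (ltW x0) V0) xx.
  rewrite -(powR_inv1 (ltW s20)) -powRrM mulN1r powRN.
  by rewrite ler_pdivrMr.
rewrite xV expRN ler_pdivrMr ?expR_gt0// mulrAC ler_pdivlMr//.
by rewrite [leRHS]mulrC.
Qed.

Lemma gamma_integral_pred_le s (C : R) : 0 < s ->
  (\int[mu]_(x in `]0%R, +oo[) (gamma_kernel (s + 1) x)%:E <= C%:E)%E ->
  (\int[mu]_(x in `]0%R, +oo[) (gamma_kernel s x)%:E <= (C / s)%:E)%E.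
Proof.
move=> s0 hC.
suff : (\int[mu]_(x in `]0%R, +oo[) (s * gamma_kernel s x)%:E <= C%:E)%E.
  under eq_integral do rewrite EFinM.
  rewrite ge0_integralZl//=; last 3 first.
  + by apply/measurable_EFinP; apply: measurable_gamma_kernel.
  + by move=> x _; rewrite lee_fin gamma_kernel_ge0.
  + by rewrite lee_fin ltW.
  move=> h; rewrite mulrC EFinM -[leLHS]mul1e -[1%E](_ : (s^-1 * s)%:E = _).
    rewrite EFinM -muleA lee_wpmul2l//.
    by rewrite lee_fin invr_ge0 ltW.
  by rewrite mulVf// gt_eqF.
rewrite -exhaustE.
apply: (@integral_le_exhaustion _ _ _ _
  (fun n => (2 * s) `^ (2 * s) * (n.+2%:R^-1 : R) `^ s)).
- exact: exhaust_nd.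
- by move=> n; exact: measurable_itv.
- by apply: measurable_funM => //; exact: measurable_gamma_kernel.
- by move=> n x _; rewrite mulr_ge0 ?gamma_kernel_ge0 ?ltW.
- move=> n.
  have dF x : (n.+2%:R)^-1 <= x <= n.+2%:R -> is_derive x 1
      (gamma_kernel (s + 1))
      (s * gamma_kernel s x - gamma_kernel (s + 1) x).
    by move=> /exhaust_gt0 x0; exact: is_derive_gamma_kernel.
  rewrite /exhaust (integral_add_is_derive (exhaust_lt n) dF); last 2 first.
  + move=> x /exhaust_gt0 x0; apply: continuousM; first exact: cst_continuous.
    exact: continuous_gamma_kernel.
  + by move=> x /exhaust_gt0 x0; exact: continuous_gamma_kernel.
  rewrite [leRHS]EFinD; apply: leeD.
    apply: le_trans hC.
    exact: integral_exhaust_le.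
  rewrite lee_fin lerBlDr (le_trans (gamma_kernel_decay s0 _))//.
  by rewrite lerDl gamma_kernel_ge0.
- rewrite -[X in _ --> X](mulr0 ((2 * s) `^ (2 * s))).
  by apply: cvgM; [exact: cvg_cst|exact: cvg_exhaust_powR].
Qed.
End gamma_integrals.

(** * Moments of the Gamma and normal laws *)

(** The Gamma variable is only almost surely positive. Replacing its other
    values by 1 keeps every trajectory in the half-line and changes nothing
    almost surely. *)
Definition pos_or_one (R : realType) (g : R) : R := if 0 < g then g else 1.

Lemma pos_or_one_gt0 (R : realType) (g : R) : 0 < pos_or_one g.
Proof. by rewrite /pos_or_one; case: ifP. Qed.

Lemma measurable_pos_or_one (R : realType) :
  measurable_fun setT (@pos_or_one R).
Proof.
apply: measurable_fun_ifT => //.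
by apply: measurable_fun_ltr => //; exact: measurable_cst.
Qed.

(** Lebesgue measure is defined on a copy of the reals whose measurable
    structure carries another display; it is transported along the identity.
    *)
Lemma ge0_integral_lebesgue_density (R : realType)
    (nu : {measure set R -> \bar R}) (p : R -> R) (f : R -> \bar R) :
  measurable_fun setT p -> (forall x, 0 <= p x) ->
  (forall A : set R, measurable A ->
     nu A = \int[lebesgue_measure]_(x in A) (p x)%:E)%E ->
  measurable_fun setT f -> (forall x, 0 <= f x)%E ->
  (\int[nu]_x f x = \int[lebesgue_measure]_x (f x * (p x)%:E))%E.
Proof.
move=> mp p0 nuE mf f0.
pose iR : measurableTypeR R -> R := idfun.
have mi : measurable_fun setT iR by move=> _ A mA; rewrite setTI.
pose m0 : {measure set R -> \bar R} := pushforward lebesgue_measure iR.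
rewrite (@ge0_integral_density _ _ _ (m0 mi) nu p)//.
  rewrite ge0_integral_pushforward//.
    by apply: emeasurable_funM => //; exact/measurable_EFinP.
  by move=> x _; rewrite mule_ge0// lee_fin.
move=> A mA; rewrite nuE// ge0_integral_pushforward//.
  by apply/measurable_EFinP; exact: measurable_funS mp.
by move=> x _; rewrite lee_fin.
Qed.

Section gamma_law.
Context (R : realType) (a : R) (nu : probability R R).
Hypotheses (a_gt0 : 0 < a)
  (nuE : forall A : set R, measurable A -> nu A = gamma_prob a A).
Notation mu := lebesgue_measure.

Lemma Gamma_fun_ge0 : 0 <= Gamma_fun a.
Proof.
by apply: Rintegral_ge0 => x _; rewrite mulr_ge0 ?powR_ge0 ?expR_ge0.
Qed.

Lemma gamma_pdf_ge0 x : 0 <= gamma_pdf a x.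
Proof.
rewrite /gamma_pdf; case: ifP => // _.
by rewrite divr_ge0 ?Gamma_fun_ge0// mulr_ge0 ?powR_ge0 ?expR_ge0.
Qed.

Lemma measurable_gamma_pdf : measurable_fun setT (gamma_pdf a).
Proof.
apply: measurable_fun_ifT => //.
  by apply: measurable_fun_ltr => //; exact: measurable_cst.
apply: measurable_funM => //; exact: measurable_gamma_kernel.
Qed.

Lemma integral_gamma_law (k : R -> R) :
  measurable_fun setT k -> (forall x, 0 <= k x) ->
  (\int[nu]_x (k x)%:E = (Gamma_fun a)^-1%:E *
     \int[mu]_(x in `]0%R, +oo[) (k x * gamma_kernel a x)%:E)%E.
Proof.
move=> mk k0.
rewrite (@ge0_integral_lebesgue_density R nu (gamma_pdf a))//; last 3 first.
- exact: measurable_gamma_pdf.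
- exact: gamma_pdf_ge0.
- exact/measurable_EFinP.
rewrite -ge0_integralZl//=; last 3 first.
- apply/measurable_EFinP; apply: measurable_funM.
    exact: measurable_funS mk.
  exact: measurable_gamma_kernel.
- by move=> x _; rewrite lee_fin mulr_ge0// gamma_kernel_ge0.
- by rewrite lee_fin invr_ge0 Gamma_fun_ge0.
rewrite [RHS]integral_mkcond; apply: eq_integral => x _.
rewrite patchE mem_setE in_itv/= andbT /gamma_pdf; case: ifP => _.
  by rewrite -!EFinM; congr EFin; rewrite mulrA [LHS]mulrC mulrA.
by rewrite mule0.
Qed.

(** Since [nu] has mass 1, the normalizing constant cannot be the junk value 0
    that it would take if the integral were infinite. *)
Lemma gamma_law_mass : 0 < Gamma_fun a /\
  (\int[mu]_(x in `]0%R, +oo[) (gamma_kernel a x)%:E = (Gamma_fun a)%:E)%E.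
Proof.
have h : (1 = (Gamma_fun a)^-1%:E *
    \int[mu]_(x in `]0%R, +oo[) (gamma_kernel a x)%:E)%E.
  have := @integral_gamma_law (fun=> 1) (measurable_cst _) (fun=> ler01).
  rewrite integral_cst// mul1e [X in X = _](_ : _ = 1%E); last exact: probability_setT.
  by move=> {1}->; under eq_integral do rewrite mul1r.
have G0 : Gamma_fun a != 0.
  apply/eqP => G0; move: h; rewrite G0 invr0 mul0e => /eqP.
  by rewrite onee_eq0.
split; first by rewrite lt_def G0 Gamma_fun_ge0.
have := congr1 (fun t => (Gamma_fun a)%:E * t)%E h.
by rewrite mule1 muleA -EFinM divff// mul1e => <-.
Qed.

Lemma gamma_law_mean : (\int[nu]_x (pos_or_one x)%:E <= a%:E)%E.
Proof.
have [G0 mass] := gamma_law_mass.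
rewrite integral_gamma_law; last 2 first.
- exact: measurable_pos_or_one.
- by move=> x; rewrite ltW// pos_or_one_gt0.
have -> : (\int[mu]_(x in `]0%R, +oo[) (pos_or_one x * gamma_kernel a x)%:E =
    \int[mu]_(x in `]0%R, +oo[) (gamma_kernel (a + 1) x)%:E)%E.
  apply: eq_integral => x /[!inE]/=; rewrite in_itv/= andbT => x0.
  rewrite /pos_or_one x0 /gamma_kernel mulrA addrK mulr_powRB1//.
  exact: ltW.
have := @gamma_integralS_le _ a (Gamma_fun a) a_gt0; rewrite mass.
move=> /(_ (lexx _)) h.
have GV : (0 <= (Gamma_fun a)^-1%:E)%E by rewrite lee_fin invr_ge0 ltW.
rewrite (le_trans (lee_wpmul2l GV h))// -EFinM lee_fin.
by rewrite mulrCA mulVf ?mulr1// gt_eqF.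
Qed.

Lemma gamma_law_inv_mean : 1 < a ->
  (\int[nu]_x ((pos_or_one x)^-1)%:E <= ((a - 1)^-1)%:E)%E.
Proof.
move=> a1.
have [G0 mass] := gamma_law_mass.
rewrite integral_gamma_law; last 2 first.
- apply: measurableT_comp; first exact: measurable_inv.
  exact: measurable_pos_or_one.
- by move=> x; rewrite invr_ge0 ltW// pos_or_one_gt0.
have -> : (\int[mu]_(x in `]0%R, +oo[)
      ((pos_or_one x)^-1 * gamma_kernel a x)%:E =
    \int[mu]_(x in `]0%R, +oo[) (gamma_kernel (a - 1) x)%:E)%E.
  apply: eq_integral => x /[!inE]/=; rewrite in_itv/= andbT => x0.
  rewrite /pos_or_one x0 /gamma_kernel mulrA; congr (_ * _)%:E.
  rewrite -(@mulr_powRB1 _ x (a - 1)) ?subr_gt0// ?ltW//.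
  by rewrite mulrA mulVf ?mul1r// gt_eqF.
have := @gamma_integral_pred_le _ (a - 1) (Gamma_fun a); rewrite subrK mass.
rewrite subr_gt0 => /(_ a1 (lexx _)) h.
have GV : (0 <= (Gamma_fun a)^-1%:E)%E by rewrite lee_fin invr_ge0 ltW.
rewrite (le_trans (lee_wpmul2l GV h))// -EFinM lee_fin.
by rewrite mulrA mulVf ?mul1r// gt_eqF.
Qed.

Lemma gamma_law_nonpos : nu `]-oo, 0%R]%classic = 0%E.
Proof.
rewrite nuE; last exact: measurable_itv.
rewrite /gamma_prob integral0_eq// => x /=; rewrite in_itv/= => x0.
by rewrite /gamma_pdf ltNge x0.
Qed.
End gamma_law.

Section normal_law.
Context (R : realType) (nu : probability R R).
Hypothesis
  nuE : forall A : set R, measurable A -> nu A = normal_prob 0 1 A.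

Lemma integral_normal_law (k : R -> R) :
  measurable_fun setT k -> (forall x, 0 <= k x) ->
  (\int[nu]_x (k x)%:E = \int[lebesgue_measure]_x
     (k x * normal_pdf 0 1 x)%:E)%E.
Proof.
move=> mk k0.
rewrite (@ge0_integral_lebesgue_density R nu (normal_pdf 0 1))//.
- exact: measurable_normal_pdf.
- exact: normal_pdf_ge0.
- exact/measurable_EFinP.
Qed.

(** Expanding the product leaves a term (3/2) k |z|, which is bounded by (3/4)
    k (1 + z^2); only the second moment is then needed. *)
Lemma normal_law_quadratic (k : R) : 0 <= k ->
  (\int[nu]_z ((`|z| + k) * (`|z| / 2 + k))%:E <=
   ((k + 1) * (k + 1 / 2))%:E)%E.
Proof.
move=> k0.
have e z : 0 <= z ^+ 2 :> R by exact: sqr_ge0.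
apply: (@le_trans _ _ (\int[nu]_z
    ((k ^+ 2 + 3 / 4 * k)%:E + ((1 / 2 + 3 / 4 * k) * z ^+ 2)%:E))%E).
  apply: le_integral_upper => [z||z].
  - by rewrite lee_fin !mulr_ge0 ?addr_ge0 ?divr_ge0.
  - apply: emeasurable_funD => //; apply/measurable_EFinP.
    by apply: measurable_funM => //; exact: measurable_funX.
  rewrite -EFinD lee_fin -(real_normK (num_real z)).
  have : 0 <= (`|z| - 1) ^+ 2 * k by rewrite mulr_ge0// sqr_ge0.
  by move: (`|z|) => y h; nra.
have c1 : 0 <= k ^+ 2 + 3 / 4 * k by nra.
have c2 : 0 <= 1 / 2 + 3 / 4 * k by nra.
rewrite ge0_integralD//; last 2 first.
- by move=> z _; rewrite lee_fin mulr_ge0.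
- by apply/measurable_EFinP; apply: measurable_funM => //; exact: measurable_funX.
rewrite integral_cst// [X in (_ * X + _)%E](_ : _ = 1%E);
  last exact: probability_setT.
rewrite mule1 integral_normal_law; last 2 first.
- by apply: measurable_funM => //; exact: measurable_funX.
- by move=> z; rewrite mulr_ge0.
under eq_integral => z _.
  rewrite (_ : (_ * normal_pdf 0 1 z)%R =
    ((1 / 2 + 3 / 4 * k) * (z ^+ 2 * normal_pdf 0 1 z))%R); last by rewrite [RHS]mulrA.
  rewrite EFinM; over.
rewrite ge0_integralZl//; last 2 first.
- apply/measurable_EFinP; apply: measurable_funM; first exact: measurable_funX.
  exact: measurable_normal_pdf.
- by move=> z _; rewrite lee_fin mulr_ge0// normal_pdf_ge0.
have c2E : (0 <= (1 / 2 + 3 / 4 * k)%:E)%E by rewrite lee_fin.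
have := lee_wpmul2l c2E (std_normal_second_moment R); rewrite mule1 => h.
apply: (le_trans (leeD2l _ h)); rewrite -EFinD lee_fin.
by nra.
Qed.
End normal_law.

(** * The derivative of the Gibbs map *)

Section gibbs_derivative.
Context (R : realType) (J : nat) (Y : 'I_J -> R) (beta K : R).
Hypotheses (hJ : (1 <= J)%N) (hK : 0 <= K) (hS : 0 < Sigma0 Y beta).
Let j : R := J%:R.
Let S0 := Sigma0 Y beta.
Let c := sample_mean Y.

(** The quantity u that is squared in the Gibbs map, with [gibbs_dev_slope]
    its derivative in [s] divided by J, and [gibbs_rate] the denominator of
    the map. *)
Definition gibbs_dev (z s : R) : R :=
  z / Num.sqrt (s * j + K) - c * K / (s * j + K).

Definition gibbs_dev_slope (z s : R) : R :=
  c * K / (s * j + K) ^+ 2 - z / (2 * (s * j + K) * Num.sqrt (s * j + K)).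

Definition gibbs_rate (z s : R) : R := S0 + j / 2 * gibbs_dev z s ^+ 2.

(** The absolute value of the derivative of the Gibbs map. *)
Definition gibbs_slope (z g s : R) : R :=
  `|g * j ^+ 2 * gibbs_dev z s * gibbs_dev_slope z s / gibbs_rate z s ^+ 2|.

Lemma j_gt0 : 0 < j. Proof. by rewrite ltr0n. Qed.

Lemma sjK_gt0 s : 0 < s -> 0 < s * j + K.
Proof. by move=> s0; rewrite ltr_pwDl// mulr_gt0// j_gt0. Qed.

Lemma gibbs_rate_ge z s : S0 <= gibbs_rate z s.
Proof. by rewrite lerDl mulr_ge0 ?sqr_ge0// divr_ge0// ltW// j_gt0. Qed.

Lemma gibbs_rate_gt0 z s : 0 < gibbs_rate z s.
Proof. exact: lt_le_trans hS (gibbs_rate_ge z s). Qed.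

Lemma gibbs_mapE z g s : gibbs_map Y beta K z g s = g / gibbs_rate z s.
Proof. by []. Qed.

Lemma gibbs_map_gt0 z g s : 0 < g -> 0 < gibbs_map Y beta K z g s.
Proof. by move=> g0; rewrite gibbs_mapE divr_gt0// gibbs_rate_gt0. Qed.

Lemma gibbs_slope_ge0 z g s : 0 <= gibbs_slope z g s.
Proof. exact: normr_ge0. Qed.

Lemma is_derive_gibbs_dev (z s : R) : 0 < s ->
  is_derive s 1 (gibbs_dev z) (j * gibbs_dev_slope z s).
Proof.
move=> s0; have t0 := sjK_gt0 s0.
have w0 : 0 < Num.sqrt (s * j + K) by rewrite sqrtr_gt0.
have ht := is_derive_add (is_derive_mul (is_derive_var s)
  (is_derive_const j s)) (is_derive_const K s).
have hw := is_derive_chain ht (is_derive1_sqrt t0).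
have h1 := is_derive_mul (is_derive_const z s)
  (is_derive_inv hw (lt0r_neq0 w0)).
have h2 := is_derive_mul (is_derive_const (c * K) s)
  (is_derive_inv ht (lt0r_neq0 t0)).
apply: (is_derive_eq (is_derive_sub h1 h2)).
rewrite /gibbs_dev_slope /=.
have tE : s * j + K = Num.sqrt (s * j + K) ^+ 2 by rewrite sqr_sqrtr// ltW.
move: (Num.sqrt (s * j + K)) w0 tE => w w0 ->.
by field; rewrite gt_eqF.
Qed.

Lemma is_derive_gibbs_map (z g s : R) : 0 < s ->
  is_derive s 1 (gibbs_map Y beta K z g)
    (- (g * j ^+ 2 * gibbs_dev z s * gibbs_dev_slope z s
        / gibbs_rate z s ^+ 2)).
Proof.
move=> s0.
have hD := is_derive_add (is_derive_const S0 s)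
  (is_derive_mul (is_derive_const (j / 2) s)
    (is_derive_sqr (is_derive_gibbs_dev z s0))).
have D0 := gibbs_rate_gt0 z s.
apply: (is_derive_eq (is_derive_mul (is_derive_const g s)
   (is_derive_inv hD (lt0r_neq0 D0)))).
rewrite -/(gibbs_rate z s); field.
by rewrite gt_eqF.
Qed.

(** With w = sqrt (s J + K), |u| <= (|z| + k) / w and |v| <= (|z| / 2 + k) /
    w^3. The parameter [k] is left free because parts (i) and (ii) use a
    constant while part (iii) needs one that decays with [s]. *)
Lemma gibbs_dev_bound z s k : 0 < s ->
  `|c| * K / Num.sqrt (s * j + K) <= k ->
  `|gibbs_dev z s| * `|gibbs_dev_slope z s| <=
  (`|z| + k) * (`|z| / 2 + k) / (s * j + K) ^+ 2.
Proof.
move=> s0 hk; have t0 := sjK_gt0 s0.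
have w0 : 0 < Num.sqrt (s * j + K) by rewrite sqrtr_gt0.
have tE : s * j + K = Num.sqrt (s * j + K) ^+ 2 by rewrite sqr_sqrtr// ltW.
rewrite /gibbs_dev /gibbs_dev_slope.
move: (c) (Num.sqrt (s * j + K)) w0 tE hk => c' w w0 -> hk.
have k0 : 0 <= k.
  by apply: le_trans hk; rewrite !mulr_ge0// invr_ge0 ltW.
have hu : `|z / w - c' * K / w ^+ 2| <= (`|z| + k) / w.
  rewrite (le_trans (ler_normB _ _))// !normrM !normfV normrX (gtr0_norm w0).
  rewrite (ger0_norm hK) mulrDl lerD2l.
  rewrite (_ : _ / w ^+ 2 = `|c'| * K / w / w); last by field; rewrite gt_eqF.
  by rewrite ler_wpM2r// invr_ge0 ltW.
have hv : `|c' * K / w ^+ 2 ^+ 2 - z / (2 * w ^+ 2 * w)| <=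
    (`|z| / 2 + k) / w ^+ 3.
  rewrite (le_trans (ler_normB _ _))// !normrM !normfV -exprM !normrM.
  rewrite (gtr0_norm w0) (ger0_norm hK).
  have -> : `|2| = 2 :> R by rewrite ger0_norm.
  rewrite [leLHS](_ : _ = (`|z| / 2 + `|c'| * K / w) / w ^+ 3); last first.
    by field; rewrite gt_eqF.
  by rewrite ler_wpM2r ?lerD2l// invr_ge0 exprn_ge0// ltW.
apply: (le_trans (ler_pM _ _ hu hv)) => //.
rewrite le_eqVlt; apply/orP; left; apply/eqP.
by field; rewrite gt_eqF.
Qed.

Lemma gibbs_slopeE z g s : 0 < g -> gibbs_slope z g s =
  g * j ^+ 2 * (`|gibbs_dev z s| * `|gibbs_dev_slope z s|)
  / gibbs_rate z s ^+ 2.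
Proof.
move=> g0; rewrite /gibbs_slope !normrM normfV !normrX.
rewrite (gtr0_norm g0) (gtr0_norm j_gt0) (gtr0_norm (gibbs_rate_gt0 _ _)).
by rewrite !mulrA.
Qed.

Lemma gibbs_slope_le z g s k : 0 < s -> 0 < g ->
  `|c| * K / Num.sqrt (s * j + K) <= k ->
  gibbs_slope z g s <= (`|z| + k) * (`|z| / 2 + k) *
    (g * j ^+ 2 / (S0 ^+ 2 * (s * j + K) ^+ 2)).
Proof.
move=> s0 g0 hk; rewrite gibbs_slopeE//.
have t0 := sjK_gt0 s0; have := gibbs_dev_bound z s0 hk.
move: (`|gibbs_dev z s| * _) => UV hUV.
have gj : 0 <= g * j ^+ 2 by rewrite mulr_ge0 ?exprn_ge0 ?ltW// j_gt0.
rewrite (_ : _ * (_ / _) = g * j ^+ 2 *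
    ((`|z| + k) * (`|z| / 2 + k) / (s * j + K) ^+ 2) / S0 ^+ 2); last first.
  by field; rewrite !gt_eqF.
have UV0 : 0 <= (`|z| + k) * (`|z| / 2 + k) / (s * j + K) ^+ 2.
  have k0 : 0 <= k.
    by apply: le_trans hk; rewrite !mulr_ge0// invr_ge0 sqrtr_ge0.
  apply: divr_ge0; last by rewrite exprn_ge0// ltW.
  by rewrite mulr_ge0 ?addr_ge0 ?divr_ge0.
apply: (@le_trans _ _ (g * j ^+ 2 *
    ((`|z| + k) * (`|z| / 2 + k) / (s * j + K) ^+ 2) / gibbs_rate z s ^+ 2)).
  apply: ler_wpM2r; last exact: ler_wpM2l.
  by rewrite invr_ge0 exprn_ge0// ltW// gibbs_rate_gt0.
apply: ler_wpM2l; first exact: mulr_ge0.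
rewrite lef_pV2 ?posrE ?exprn_gt0 ?gibbs_rate_gt0//.
rewrite ler_pXn2r ?nnegrE ?gibbs_rate_ge ?(ltW hS)//.
by rewrite ltW// gibbs_rate_gt0.
Qed.

Lemma gibbs_slope_div_sq_le z g s k : 0 < s -> 0 < g ->
  `|c| * K / Num.sqrt (s * j + K) <= k ->
  gibbs_slope z g s / gibbs_map Y beta K z g s ^+ 2 <=
  (`|z| + k) * (`|z| / 2 + k) * (j ^+ 2 / ((s * j + K) ^+ 2 * g)).
Proof.
move=> s0 g0 hk; rewrite gibbs_slopeE// gibbs_mapE.
have t0 := sjK_gt0 s0; have D0 := gibbs_rate_gt0 z s.
have := gibbs_dev_bound z s0 hk.
move: (`|gibbs_dev z s| * _) (gibbs_rate z s) D0 => UV D D0 hUV.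
rewrite (_ : _ / (g / D) ^+ 2 = UV * (j ^+ 2 / g)); last first.
  by field; rewrite !gt_eqF.
rewrite [leRHS](_ : _ = (`|z| + k) * (`|z| / 2 + k)
   / (s * j + K) ^+ 2 * (j ^+ 2 / g)); last by field; rewrite !gt_eqF.
by rewrite ler_wpM2r// divr_ge0 ?exprn_ge0// ltW// j_gt0.
Qed.

End gibbs_derivative.

(** * The weight of part (iii) and its primitive *)

Lemma powR_three_halves (R : realType) (x : R) : 0 <= x ->
  x `^ (3 / 2) = Num.sqrt x ^+ 3.
Proof.
move=> x0; rewrite mulrC powRrM powR12_sqrt// -powR_mulrn ?sqrtr_ge0//.
Qed.

(** The convex function x^(-1/2) lies above its tangents; in terms of square
    roots the difference is (w - w0)^2 (w + 2 w0) / (2 w0^3 w). *)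
Lemma sqrtV_tangent (R : realType) (w w0 : R) : 0 < w -> 0 < w0 ->
  w0^-1 - (w ^+ 2 - w0 ^+ 2) / (2 * w0 ^+ 3) <= w^-1.
Proof.
move=> hw hw0; rewrite -subr_ge0.
rewrite (_ : _ - _ = (w - w0) ^+ 2 * (w + 2 * w0) / (2 * w0 ^+ 3 * w)).
  apply: divr_ge0; last by rewrite !mulr_ge0 ?exprn_ge0// ltW.
  by rewrite mulr_ge0 ?sqr_ge0// addr_ge0 ?mulr_ge0// ltW.
by field; rewrite !gt_eqF.
Qed.

Lemma ln_tangent (R : realType) (x x0 : R) : 0 < x -> 0 < x0 ->
  ln x <= ln x0 + (x - x0) / x0.
Proof.
move=> hx hx0; rewrite -lerBlDl -ln_div ?posrE//.
rewrite (_ : x / x0 = 1 + (x - x0) / x0); last by field; rewrite gt_eqF.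
apply: le_ln1Dx; rewrite mulrBl divff ?gt_eqF//.
by rewrite ltrBrDl subrr divr_gt0.
Qed.

Section potential.
Context (R : realType) (j m : R).
Hypotheses (j_gt0 : 0 < j) (m_ge0 : 0 <= m).

(** The function b of part (iii), with [potential] its primitive vanishing at
    0. *)
Definition weight (x : R) : R := j / Num.sqrt (2 * pi) *
  (2 * m / (x * j + 1) `^ (3 / 2) + 1 / (x * j + 1)).

Definition potential (x : R) : R := 1 / Num.sqrt (2 * pi) *
  (4 * m * (1 - 1 / Num.sqrt (x * j + 1)) + ln (x * j + 1)).

Lemma sqrt2pi_gt0 : 0 < Num.sqrt (2 * pi) :> R.
Proof. by rewrite sqrtr_gt0 mulr_gt0// pi_gt0. Qed.

Lemma affine_gt0 x : 0 <= x -> 0 < x * j + 1.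
Proof. by move=> x0; rewrite ltr_wpDl// mulr_ge0// ltW. Qed.

Lemma weightE x : 0 <= x -> weight x = j / Num.sqrt (2 * pi) *
  (2 * m / Num.sqrt (x * j + 1) ^+ 3 + 1 / Num.sqrt (x * j + 1) ^+ 2).
Proof.
move=> x0; have t0 := affine_gt0 x0.
by rewrite /weight powR_three_halves ?sqr_sqrtr// ltW.
Qed.

Lemma weight_ge0 x : 0 <= x -> 0 <= weight x.
Proof.
move=> x0; have t0 := affine_gt0 x0.
rewrite /weight; apply: mulr_ge0; first by rewrite divr_ge0 ?sqrtr_ge0// ltW.
by rewrite addr_ge0// divr_ge0 ?mulr_ge0 ?powR_ge0// ltW.
Qed.

Lemma is_derive_potential (x : R) : 0 < x ->
  is_derive x 1 potential (weight x).
Proof.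
move=> x0; have t0 := affine_gt0 (ltW x0).
have w0 : 0 < Num.sqrt (x * j + 1) by rewrite sqrtr_gt0.
have ht := is_derive_add (is_derive_mul (is_derive_var x)
  (is_derive_const j x)) (is_derive_const 1 x).
have hw := is_derive_chain ht (is_derive1_sqrt t0).
have h1 := is_derive_mul (is_derive_const 1 x)
  (is_derive_inv hw (lt0r_neq0 w0)).
have h2 := is_derive_mul (is_derive_const (4 * m) x)
  (is_derive_sub (is_derive_const 1 x) h1).
have h3 := is_derive_chain ht (is_derive1_ln t0).
apply: (is_derive_eq (is_derive_mul (is_derive_const (1 / Num.sqrt (2 * pi)) x)
  (is_derive_add h2 h3))).
rewrite weightE ?ltW//=.
have tE : x * j + 1 = Num.sqrt (x * j + 1) ^+ 2 by rewrite sqr_sqrtr// ltW.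
have := sqrt2pi_gt0; move: (Num.sqrt (2 * pi)) => p p0.
move: (Num.sqrt (x * j + 1)) w0 tE => w w0 ->.
by field; rewrite !gt_eqF.
Qed.

Lemma weight_continuous (x : R) : 0 < x -> {for x, continuous weight}.
Proof.
move=> x0; have t0 := affine_gt0 (ltW x0).
have ht := is_derive_add (is_derive_mul (is_derive_var x)
  (is_derive_const j x)) (is_derive_const 1 x).
have hp := is_derive_chain ht (is_derive1_powR (3 / 2) t0).
have p0 : (x * j + 1) `^ (3 / 2) != 0 by rewrite gt_eqF// powR_gt0.
have h1 := is_derive_mul (is_derive_const (2 * m) x) (is_derive_inv hp p0).
have h2 := is_derive_mul (is_derive_const 1 x)
  (is_derive_inv ht (lt0r_neq0 t0)).
exact: is_derive_continuous (is_derive_mul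
  (is_derive_const (j / Num.sqrt (2 * pi)) x) (is_derive_add h1 h2)).
Qed.

(** Concavity of the primitive of a decreasing function, obtained from the
    tangents of ln x and of x^(-1/2). *)
Lemma potential_tangent x y : 0 <= x -> 0 <= y ->
  potential y <= potential x + weight x * (y - x).
Proof.
move=> x0 y0; have tx := affine_gt0 x0; have ty := affine_gt0 y0.
have wx : 0 < Num.sqrt (x * j + 1) by rewrite sqrtr_gt0.
have wy : 0 < Num.sqrt (y * j + 1) by rewrite sqrtr_gt0.
have txE : Num.sqrt (x * j + 1) ^+ 2 = x * j + 1 by rewrite sqr_sqrtr// ltW.
have tyE : Num.sqrt (y * j + 1) ^+ 2 = y * j + 1 by rewrite sqr_sqrtr// ltW.
have h1 := sqrtV_tangent wy wx.
have h2 := ln_tangent ty tx.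
rewrite weightE// /potential txE.
have p0 : 0 <= 1 / Num.sqrt (2 * pi) :> R.
  by rewrite divr_ge0// ltW// sqrt2pi_gt0.
set w := Num.sqrt (x * j + 1) in h1 txE wx *.
rewrite (_ : _ + _ * (y - x) = 1 / Num.sqrt (2 * pi) *
  (4 * m * (1 - (w^-1 - (y * j - x * j) / (2 * w ^+ 3)))
   + (ln (x * j + 1) + (y * j - x * j) / (x * j + 1)))); last first.
  by field; rewrite !gt_eqF// sqrt2pi_gt0.
rewrite ler_wpM2l// lerD//.
  rewrite ler_wpM2l ?mulr_ge0// lerD2l lerN2 div1r (le_trans _ h1)//.
  by rewrite txE tyE opprD addrACA subrr addr0.
by apply: le_trans h2 _; rewrite opprD addrACA subrr addr0.
Qed.

Lemma potential0 : potential 0 = 0.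
Proof. by rewrite /potential mul0r add0r sqrtr1 divr1 subrr mulr0 ln1 addr0 mulr0. Qed.

Lemma potential_ge0 x : 0 <= x -> 0 <= potential x.
Proof.
move=> x0; have t0 := affine_gt0 x0.
have w1 : 1 <= Num.sqrt (x * j + 1).
  by rewrite -[leLHS]sqrtr1 ler_wsqrtr// lerDr mulr_ge0// ltW.
rewrite /potential; apply: mulr_ge0.
  by rewrite divr_ge0// ltW// sqrt2pi_gt0.
rewrite addr_ge0//.
  rewrite !mulr_ge0// subr_ge0 div1r invf_le1//.
  exact: lt_le_trans w1.
by rewrite ln_ge0// lerDr mulr_ge0// ltW.
Qed.

(** The intercept of a tangent is at least the value 0 at the origin. The
    affine majorant of [potential] therefore has nonnegative coefficients, and
    it can be integrated term by term. *)
Lemma potential_affine_bound x : 0 <= x ->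
  0 <= potential x - weight x * x.
Proof.
move=> x0; have := potential_tangent x0 (lexx 0).
by rewrite potential0 sub0r mulrN.
Qed.
End potential.

(** * Total variation of the primitive along the Gibbs map *)

Section measurability.
Context (R : realType) (J : nat) (Y : 'I_J -> R) (beta K : R).
Let j : R := J%:R.

Context (d : measure_display) (T : measurableType d).
Implicit Types (z g s : T -> R).

Lemma measurable_div_comp (f g : T -> R) : measurable_fun setT f ->
  measurable_fun setT g -> measurable_fun setT (fun x => f x / g x).
Proof.
move=> mf mg; apply: measurable_funM => //.
exact: measurableT_comp (@measurable_inv R) mg.
Qed.

Lemma measurable_gibbs_dev z s : measurable_fun setT z ->
  measurable_fun setT s -> measurable_fun setT (fun x => gibbs_dev Y K (z x) (s x)).
Proof.
move=> mz ms.
have mt : measurable_fun setT (fun x => s x * j + K).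
  by apply: measurable_funD => //; exact: measurable_funM.
apply: measurable_funB; apply: measurable_div_comp => //.
by apply: measurableT_comp mt; exact: measurable_sqrt.
Qed.

Lemma measurable_gibbs_dev_slope z s : measurable_fun setT z ->
  measurable_fun setT s ->
  measurable_fun setT (fun x => gibbs_dev_slope Y K (z x) (s x)).
Proof.
move=> mz ms.
have mt : measurable_fun setT (fun x => s x * j + K).
  by apply: measurable_funD => //; exact: measurable_funM.
apply: measurable_funB; apply: measurable_div_comp => //.
  exact: measurable_funX.
apply: measurable_funM; first exact: measurable_funM.
by apply: measurableT_comp mt; exact: measurable_sqrt.
Qed.

Lemma measurable_gibbs_rate z s : measurable_fun setT z ->
  measurable_fun setT s ->
  measurable_fun setT (fun x => gibbs_rate Y beta K (z x) (s x)).
Proof.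
move=> mz ms; apply: measurable_funD => //; apply: measurable_funM => //.
by apply: measurable_funX; exact: measurable_gibbs_dev.
Qed.

Lemma measurable_gibbs_map z g s : measurable_fun setT z ->
  measurable_fun setT g -> measurable_fun setT s ->
  measurable_fun setT (fun x => gibbs_map Y beta K (z x) (g x) (s x)).
Proof.
by move=> mz mg ms; apply: measurable_div_comp => //; exact: measurable_gibbs_rate.
Qed.

Lemma measurable_gibbs_slope z g s : measurable_fun setT z ->
  measurable_fun setT g -> measurable_fun setT s ->
  measurable_fun setT (fun x => gibbs_slope Y beta K (z x) (g x) (s x)).
Proof.
move=> mz mg ms; apply: measurableT_comp => //.
apply: measurable_div_comp; last first.
  by apply: measurable_funX; exact: measurable_gibbs_rate.
apply: measurable_funM; last exact: measurable_gibbs_dev_slope.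
apply: measurable_funM; last exact: measurable_gibbs_dev.
exact: measurable_funM.
Qed.
End measurability.

Lemma measurable_weight (R : realType) (j m : R) :
  measurable_fun setT (weight j m).
Proof.
have mt : measurable_fun setT (fun x : R => x * j + 1).
  by apply: measurable_funD => //; exact: measurable_funM.
apply: measurable_funM => //.
apply: measurable_funD; apply: measurable_div_comp => //.
exact: measurableT_comp (measurable_powR _) mt.
Qed.

Section gibbs_potential.
Context (R : realType) (J : nat) (Y : 'I_J -> R) (beta : R).
Hypotheses (hJ : (1 <= J)%N) (hS : 0 < Sigma0 Y beta).
Let j : R := J%:R.
Let S0 := Sigma0 Y beta.
Let c := sample_mean Y.
Let m := `|c|.

(** Uses e^(-z^2/2) <= 1 and |z| e^(-z^2/2) <= 1 on the two terms of v. *)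
Lemma gibbs_dev_slope_pdf_le (z s : R) : 0 < s ->
  j * Num.sqrt (s * j + 1) * `|gibbs_dev_slope Y 1 z s| * normal_pdf 0 1 z <=
  weight j m s / 2.
Proof.
move=> s0; have t0 : 0 < s * j + 1 by exact: sjK_gt0.
have j0 : 0 < j by rewrite ltr0n.
have w0 : 0 < Num.sqrt (s * j + 1) by rewrite sqrtr_gt0.
have tE : s * j + 1 = Num.sqrt (s * j + 1) ^+ 2 by rewrite sqr_sqrtr// ltW.
have p0 : 0 < Num.sqrt (2 * pi) :> R by exact: sqrt2pi_gt0.
rewrite weightE ?(ltW s0)// std_normal_pdfE /gibbs_dev_slope -/j -/c /m.
have e1 : expR (- (z ^+ 2 / 2)) <= 1.
  by rewrite -[leRHS]expR0 ler_expR oppr_le0 divr_ge0 ?sqr_ge0.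
have e2 : `|z| * expR (- (z ^+ 2 / 2)) <= 1.
  rewrite expRN ler_pdivrMr ?expR_gt0// mul1r.
  apply: (le_trans _ (expR_ge1Dx _)).
  have := sqr_ge0 (`|z| - 1); rewrite -(real_normK (num_real z)).
  by move: (`|z|) => y hy; nra.
have e0 := expR_ge0 (- (z ^+ 2 / 2)).
move: (c) (Num.sqrt (2 * pi)) p0 (Num.sqrt (s * j + 1)) w0 tE
  => c' p p0 w w0 ->.
move: (expR _) e0 e1 e2 => e e0 e1 e2.
have hv : `|c' * 1 / w ^+ 2 ^+ 2 - z / (2 * w ^+ 2 * w)| <=
    `|c'| / w ^+ 4 + `|z| / (2 * w ^+ 3).
  rewrite (le_trans (ler_normB _ _))// mulr1 -exprM -mulrA -exprSr.
  rewrite !normrM !normfV.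
  by rewrite (ger0_norm (_ : 0 <= w ^+ 4)) ?(ger0_norm (_ : 0 <= 2 * w ^+ 3))
    ?mulr_ge0 ?exprn_ge0// ltW.
have jw : 0 <= j * w by rewrite mulr_ge0// ltW.
have ep : 0 <= p^-1 * e by rewrite mulr_ge0// invr_ge0 ltW.
apply: (le_trans (ler_wpM2r ep (ler_wpM2l jw hv))).
rewrite [leLHS](_ : _ = j / p * (`|c'| / w ^+ 3 * e + `|z| * e / (2 * w ^+ 2)));
  last by field; rewrite !gt_eqF.
rewrite [leRHS](_ : _ = j / p * (`|c'| / w ^+ 3 * 1 + 1 / (2 * w ^+ 2)));
  last by field; rewrite !gt_eqF.
apply: ler_wpM2l; first by rewrite divr_ge0 ?ltW.
apply: lerD; first by rewrite ler_wpM2l// divr_ge0// exprn_ge0// ltW.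
by rewrite ler_wpM2r// invr_ge0 mulr_ge0// exprn_ge0// ltW.
Qed.

(** The map depends on [s] and on [z] through u only, so its two partial
    derivatives have a common factor, and their ratio is J sqrt t |v|. The
    factor between the absolute value bars on the right is the derivative of
    [potential] composed with the map, as a function of [z]. *)
Lemma gibbs_slope_weight_le (z g s : R) : 0 < s -> 0 < g ->
  gibbs_slope Y beta 1 z g s * weight j m (gibbs_map Y beta 1 z g s)
    * normal_pdf 0 1 z <=
  weight j m s / 2 *
  `|weight j m (gibbs_map Y beta 1 z g s) *
    - (g * j * gibbs_dev Y 1 z s /
      (Num.sqrt (s * j + 1) * gibbs_rate Y beta 1 z s ^+ 2))|.
Proof.
move=> s0 g0; have := gibbs_dev_slope_pdf_le z s0.
have t0 : 0 < s * j + 1 by exact: sjK_gt0.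
have j0 : 0 < j by rewrite ltr0n.
have w0 : 0 < Num.sqrt (s * j + 1) by rewrite sqrtr_gt0.
have D0 := gibbs_rate_gt0 1 hS z s.
have m0 : 0 <= m by exact: normr_ge0.
have W0 : 0 <= weight j m (gibbs_map Y beta 1 z g s).
  by apply: weight_ge0 => //; apply: ltW; exact: gibbs_map_gt0.
rewrite gibbs_slopeE// normrM (ger0_norm W0) normrN !normrM normfV.
rewrite [`|_ * gibbs_rate _ _ _ _ _ ^+ 2|]ger0_norm; last first.
  by rewrite mulr_ge0 ?exprn_ge0// ltW.
rewrite (gtr0_norm g0) (gtr0_norm j0) -/j.
move: (weight j m _) W0 (gibbs_rate _ _ _ _ _) D0 (Num.sqrt _) w0
  => W W0 D D0 w w0.
move: (`|gibbs_dev _ _ _ _|) (normr_ge0 (gibbs_dev Y 1 z s)) => u u0.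
move: (`|gibbs_dev_slope _ _ _ _|) (normal_pdf 0 1 z) => v p h.
have k0 : 0 <= g * j * u * W / (w * D ^+ 2).
  by rewrite divr_ge0 ?mulr_ge0 ?exprn_ge0// ltW.
rewrite [leLHS](_ : _ = j * w * v * p * (g * j * u * W / (w * D ^+ 2)));
  last by field; rewrite !gt_eqF.
rewrite [leRHS](_ : _ = weight j m s / 2 * (g * j * u * W / (w * D ^+ 2)));
  last by field; rewrite !gt_eqF.
exact: ler_wpM2r.
Qed.

Lemma is_derive_gibbs_map_noise (z g s : R) : 0 < s -> 0 < g ->
  is_derive z 1 (fun z => gibbs_map Y beta 1 z g s)
   (- (g * j * gibbs_dev Y 1 z s /
      (Num.sqrt (s * j + 1) * gibbs_rate Y beta 1 z s ^+ 2))).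
Proof.
move=> s0 g0.
have t0 : 0 < s * j + 1 by exact: sjK_gt0.
have w0 : 0 < Num.sqrt (s * j + 1) by rewrite sqrtr_gt0.
have hu := is_derive_sub (is_derive_mul (is_derive_var z)
  (is_derive_const (Num.sqrt (s * j + 1))^-1 z))
  (is_derive_const (c * 1 / (s * j + 1)) z).
have hD := is_derive_add (is_derive_const S0 z)
  (is_derive_mul (is_derive_const (j / 2) z) (is_derive_sqr hu)).
have D0 := gibbs_rate_gt0 1 hS z s.
apply: (is_derive_eq (is_derive_mul (is_derive_const g z)
  (is_derive_inv hD (lt0r_neq0 D0)))).
rewrite -/(gibbs_dev Y 1 z s) -/(gibbs_rate Y beta 1 z s).
move: (Num.sqrt _) w0 => w w0; move: (gibbs_rate _ _ _ _ _) D0 => D D0.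
by field; rewrite !gt_eqF.
Qed.

Lemma continuous_gibbs_map_noise_slope (g s : R) : 0 < s -> 0 < g ->
  continuous (fun z => weight j m (gibbs_map Y beta 1 z g s) *
    - (g * j * gibbs_dev Y 1 z s /
      (Num.sqrt (s * j + 1) * gibbs_rate Y beta 1 z s ^+ 2))).
Proof.
move=> s0 g0 z.
have t0 : 0 < s * j + 1 by exact: sjK_gt0.
have w0 : 0 < Num.sqrt (s * j + 1) by rewrite sqrtr_gt0.
have D0 := gibbs_rate_gt0 1 hS z s.
have cq := is_derive_continuous (is_derive_gibbs_map_noise z s0 g0).
have cw : {for gibbs_map Y beta 1 z g s, continuous (weight j m)}.
  by apply: weight_continuous; [rewrite ltr0n|exact: gibbs_map_gt0].
have cwq : {for z, continuous (fun z => weight j m (gibbs_map Y beta 1 z g s))}.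
  exact: (continuous_comp cq cw).
have hu := is_derive_sub (is_derive_mul (is_derive_var z)
  (is_derive_const (Num.sqrt (s * j + 1))^-1 z))
  (is_derive_const (c * 1 / (s * j + 1)) z).
have hD := is_derive_add (is_derive_const S0 z)
  (is_derive_mul (is_derive_const (j / 2) z) (is_derive_sqr hu)).
have wD0 : Num.sqrt (s * j + 1) * gibbs_rate Y beta 1 z s ^+ 2 != 0.
  by rewrite mulf_neq0// ?expf_neq0// gt_eqF.
have hwD := is_derive_mul (is_derive_const (Num.sqrt (s * j + 1)) z)
  (is_derive_sqr hD).
have cr := is_derive_continuous (is_derive_opp (is_derive_mul
  (is_derive_mul (is_derive_const (g * j) z) hu) (is_derive_inv hwD wD0))).
exact: (continuousM cwq cr).
Qed.

(** The map is unimodal in [z], with its maximum g / S0 at the point where u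
    vanishes, so that the variation of [potential] along it is at most twice
    the value of [potential] at g / S0. *)
Lemma gibbs_potential_bound (nu : probability R R) (g s : R) :
  (forall A : set R, measurable A -> nu A = normal_prob 0 1 A) ->
  0 < s -> 0 < g ->
  (\int[nu]_z (gibbs_slope Y beta 1 z g s *
     weight j m (gibbs_map Y beta 1 z g s))%:E <=
   (weight j m s * potential j m (g / S0))%:E)%E.
Proof.
move=> nuE s0 g0.
have j0 : 0 < j by rewrite ltr0n.
have m0 : 0 <= m by exact: normr_ge0.
have t0 : 0 < s * j + 1 by exact: sjK_gt0.
have w0 : 0 < Num.sqrt (s * j + 1) by rewrite sqrtr_gt0.
have q0 z : 0 < gibbs_map Y beta 1 z g s by exact: gibbs_map_gt0.
have D0 z : 0 < gibbs_rate Y beta 1 z s by exact: gibbs_rate_gt0.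
have wt0 : 0 <= weight j m s by apply: weight_ge0 => //; exact: ltW.
pose F z := potential j m (gibbs_map Y beta 1 z g s).
pose f z := weight j m (gibbs_map Y beta 1 z g s) *
    - (g * j * gibbs_dev Y 1 z s /
      (Num.sqrt (s * j + 1) * gibbs_rate Y beta 1 z s ^+ 2)).
have dF (z : R) : is_derive z 1 F (f z).
  apply: is_derive_chain; first exact: is_derive_gibbs_map_noise.
  exact: is_derive_potential.
have cf : continuous f by exact: continuous_gibbs_map_noise_slope.
pose z0 := c / Num.sqrt (s * j + 1).
have devE z : gibbs_dev Y 1 z s = (z - z0) / Num.sqrt (s * j + 1).
  rewrite /gibbs_dev /z0 -/j -/c.
  have tE : s * j + 1 = Num.sqrt (s * j + 1) ^+ 2 by rewrite sqr_sqrtr// ltW.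
  move: (c) (Num.sqrt (s * j + 1)) w0 tE => c' w w0 ->.
  by field; rewrite gt_eqF.
have fsgn z : f z = (z0 - z) * (weight j m (gibbs_map Y beta 1 z g s) * g * j
   / (Num.sqrt (s * j + 1) ^+ 2 * gibbs_rate Y beta 1 z s ^+ 2)).
  rewrite /f devE; have := D0 z.
  move: (gibbs_rate _ _ _ _ _) => D D0'; move: (Num.sqrt _) w0 => w w0.
  by field; rewrite !gt_eqF.
have fsgn0 z : 0 <= weight j m (gibbs_map Y beta 1 z g s) * g * j
   / (Num.sqrt (s * j + 1) ^+ 2 * gibbs_rate Y beta 1 z s ^+ 2).
  apply: divr_ge0; last by rewrite mulr_ge0 ?exprn_ge0// ltW.
  apply: mulr_ge0; last exact: ltW.
  by apply: mulr_ge0; [apply: weight_ge0 => //; exact: ltW|exact: ltW].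
have var := @unimodal_variation R F f z0 (potential j m (g / S0)) dF cf.
have {}var : (\int[lebesgue_measure]_z `|f z|%:E <=
    (2 * potential j m (g / S0))%:E)%E.
  apply: var => [z zz|z zz|z|].
  - by rewrite fsgn mulr_ge0// subr_ge0.
  - by rewrite fsgn mulr_le0_ge0// subr_le0.
  - by apply: potential_ge0 => //; exact: ltW.
  - rewrite /F gibbs_mapE /gibbs_rate devE subrr mul0r expr0n mulr0 addr0.
    exact: lexx.
rewrite integral_normal_law//; last 2 first.
- apply: measurable_funM.
    exact: measurable_gibbs_slope.
  apply: measurableT_comp; first exact: measurable_weight.
  exact: measurable_gibbs_map.
- move=> z; apply: mulr_ge0; first exact: gibbs_slope_ge0.
  by apply: weight_ge0 => //; exact: ltW.
apply: (@le_trans _ _ (\int[lebesgue_measure]_z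
    ((weight j m s / 2)%:E * `|f z|%:E))%E).
  apply: le_integral_upper => [z||z].
  - rewrite lee_fin; apply: mulr_ge0; last exact: normal_pdf_ge0.
    apply: mulr_ge0; first exact: gibbs_slope_ge0.
    by apply: weight_ge0 => //; exact: ltW.
  - apply: emeasurable_funM => //; apply/measurable_EFinP.
    by apply: measurableT_comp => //; exact: continuous_measurable_fun.
  - by rewrite -EFinM lee_fin gibbs_slope_weight_le.
have wt2 : (0 <= (weight j m s / 2)%:E)%E by rewrite lee_fin divr_ge0.
rewrite ge0_integralZl//; last first.
  apply/measurable_EFinP; apply: measurableT_comp => //.
  exact: continuous_measurable_fun.
apply: (le_trans (lee_wpmul2l wt2 var)).
by rewrite -EFinM lee_fin le_eqVlt; apply/orP; left; apply/eqP; field.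
Qed.
End gibbs_potential.

(** * From the one-step inequality to drift functions *)

Lemma local_lip_ge0 (R : realType) (g : R -> R) (x : R) : (0 <= local_lip g x)%E.
Proof.
apply: limf_esup_ge0 => [|y]; first exact: filter_not_empty.
by rewrite lee_fin divr_ge0.
Qed.

(** The difference quotient converges to |g'(x)| over the punctured
    neighborhoods of x; giving it the value |g'(x)| at x turns this into a
    plain limit. *)
Lemma local_lip_le (R : realType) (g : R -> R) (x dg : R) :
  is_derive x 1 g dg -> (local_lip g x <= `|dg|%:E)%E.
Proof.
move=> hg.
pose h y : R := if y == x then `|dg| else `|g x - g y| / `|x - y|.
have hcvg : (h y)%:E @[y --> x] --> `|dg|%:E.
  apply: cvg_EFin; first exact: nearW.
  have dq : t^-1 *: (g (t *: 1 + x) - g x) @[t --> 0^'] --> dg.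
    have := @ex_derive _ _ _ _ _ _ _ hg.
    by rewrite /derivable -[X in _ -> _ --> X](@derive_val _ _ _ _ _ _ _ hg).
  move/cvgrPdist_le : dq => dq.
  apply/cvgrPdist_le => /= e e0.
  have [r /= r0 hr] := dq _ e0.
  exists r => //= y /= yr.
  rewrite /h; case: eqVneq => [_|yx]; first by rewrite subrr normr0 ltW.
  have yx0 : y - x != 0 by rewrite subr_eq0.
  have := hr (y - x); rewrite /= sub0r normrN distrC => /(_ yr yx0).
  rewrite [_ *: 1]mulr1 subrK => h1.
  have -> : `|g x - g y| / `|x - y| = `|(y - x)^-1 *: (g y - g x)|.
    by rewrite [_ *: _]mulrC normrM normfV (distrC (g x)) (distrC x).
  exact: le_trans (ler_dist_dist _ _) h1.
rewrite -(lim_lime_sup hcvg); apply: lime_sup_le.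
by apply: nearW => r y yx _; rewrite /h (negbTE yx).
Qed.

Section gibbs_chain.
Context (R : realType) (J : nat) (Y : 'I_J -> R) (beta K : R).
Hypotheses (hJ : (1 <= J)%N) (hK : 0 <= K) (hS : 0 < Sigma0 Y beta).

(** The step of the chain and its derivative, driven by the noise (z, g). *)
Definition gibbs_step (u : R * R) (s : R) : R :=
  gibbs_map Y beta K u.1 (pos_or_one u.2) s.

Definition gibbs_step_slope (u : R * R) (s : R) : R :=
  gibbs_slope Y beta K u.1 (pos_or_one u.2) s.

Lemma is_derive_iter_comp (T : Type) (Z G : nat -> T -> R) (w : T) (n : nat)
    (x : R) : 0 < x -> (forall i, 0 < G i w) ->
  exists2 D, is_derive x 1
      (iter_comp (fun i => gibbs_map Y beta K (Z i w) (G i w)) n) D &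
    `|D| = chain_deriv gibbs_step gibbs_step_slope (fun i w => (Z i w, G i w)) n w x.
Proof.
move=> + G0; elim: n x => [|n IH] x x0.
  by exists 1; [exact: is_derive_id|rewrite /= normr1].
have q0 : 0 < gibbs_map Y beta K (Z n w) (G n w) x by exact: gibbs_map_gt0.
have [D hD DE] := IH _ q0.
have hq := is_derive_gibbs_map hJ hK hS (Z n w) (G n w) x0.
exists (D * - (G n w * J%:R ^+ 2 * gibbs_dev Y K (Z n w) x
   * gibbs_dev_slope Y K (Z n w) x / gibbs_rate Y beta K (Z n w) x ^+ 2)).
  exact: (is_derive_chain hq hD).
rewrite normrM DE normrN /= /gibbs_step /gibbs_step_slope /= /pos_or_one G0.
by [].
Qed.

Lemma measurable_gibbs_step : measurable_fun setT
  (fun p : R * (R * R) => gibbs_step p.2 p.1).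
Proof.
apply: measurable_gibbs_map.
- by apply: measurableT_comp; [exact: measurable_fst|exact: measurable_snd].
- apply: measurableT_comp; first exact: measurable_pos_or_one.
  by apply: measurableT_comp; exact: measurable_snd.
- exact: measurable_fst.
Qed.

Lemma measurable_gibbs_step_slope : measurable_fun setT
  (fun p : R * (R * R) => gibbs_step_slope p.2 p.1).
Proof.
apply: measurable_gibbs_slope.
- by apply: measurableT_comp; [exact: measurable_fst|exact: measurable_snd].
- apply: measurableT_comp; first exact: measurable_pos_or_one.
  by apply: measurableT_comp; exact: measurable_snd.
- exact: measurable_fst.
Qed.
End gibbs_chain.

Section gibbs_drift.
Context (R : realType) (J : nat) (Y : 'I_J -> R) (beta K a : R).
Hypotheses (hJ : (1 <= J)%N) (hK : 0 <= K) (hS : 0 < Sigma0 Y beta)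
  (a_gt0 : 0 < a).
Context (d : measure_display) (T : measurableType d) (P : probability T R)
  (Z G : nat -> {RV P >-> R}).
Hypotheses
  (Z_law : forall (i : nat) (A : set R), measurable A ->
     distribution P (Z i) A = normal_prob 0 1 A)
  (G_law : forall (i : nat) (A : set R), measurable A ->
     distribution P (G i) A = gamma_prob a A)
  (ZG_indep : forall i : nat, independent_rv2 P (Z i) (G i))
  (pairs_indep : independent_seq P (fun i w => (Z i w, G i w))).

Lemma measurable_noise i : measurable_fun setT (fun w => (Z i w, G i w)).
Proof. by apply: measurable_fun_pair; exact: measurable_funPT. Qed.

Definition noise i : {mfun T >-> (R * R)%type} :=
  HB.pack (fun w => (Z i w, G i w))
    (@isMeasurableFun.Build _ _ _ _ (fun w => (Z i w, G i w))
       (measurable_noise i)).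

(** All the noises have the same law: it is the product of the laws of their
    two components. *)
Lemma noise_law i (A : set (R * R)) : measurable A ->
  P (noise i @^-1` A) = distribution P (noise 0) A.
Proof.
move=> mA.
have h k : (distribution P (Z 0) \x distribution P (G 0))%E A =
    distribution P (noise k) A.
  apply: product_measure_unique => // B C mB mC.
  transitivity (distribution P (Z k) B * distribution P (G k) C)%E.
    exact: ZG_indep.
  congr (_ * _)%E; first exact: etrans (Z_law k mB) (esym (Z_law 0 mB)).
  exact: etrans (G_law k mC) (esym (G_law 0 mC)).
by rewrite -(h 0) (h i).
Qed.

(** The normal variable is integrated first, for a fixed value [g] of the
    Gamma variable: the total variation argument of part (iii) needs this
    order. *)
Lemma integral_noise (h : R -> R -> R) :
  measurable_fun setT (fun u : R * R => h u.1 u.2) ->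
  (forall z g, 0 <= h z g) ->
  (\int[distribution P (noise 0)]_u (h u.1 u.2)%:E =
   \int[distribution P (G 0)]_g
     \int[distribution P (Z 0)]_z (h z g)%:E)%E.
Proof.
move=> mh h0.
have mhE : measurable_fun setT (fun u : R * R => (h u.1 u.2)%:E).
  exact/measurable_EFinP.
have msw : measurable_fun setT (fun p : R * R => (h p.2 p.1)%:E).
  have mswap : measurable_fun setT (fun p : R * R => (p.2, p.1)).
    by apply: measurable_fun_pair; [exact: measurable_snd|exact: measurable_fst].
  exact: (measurableT_comp mhE mswap).
rewrite ge0_integral_distribution//; last by move=> y; rewrite lee_fin.
rewrite (_ : \int[P]_x _ = \int[P]_w (h (Z 0 w) (G 0 w))%:E)%E//.
have -> := @indep_integral _ _ _ _ _ _ _ P (G 0) (Z 0)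
  (distribution P (Z 0)) (fun p => (h p.2 p.1)%:E) _ msw.
- rewrite ge0_integral_distribution//.
    by apply: (measurable_fun_fubini_tonelli_F _ msw) => p; rewrite lee_fin.
  by move=> y; apply: integral_ge0 => x _; rewrite lee_fin.
- by move=> B A mB mA; rewrite setIC (@ZG_indep 0 _ _ mA mB) muleC.
- by move=> p; rewrite lee_fin.
Qed.

(** Every one-step estimate reduces to a combination of 1, g and 1/g after
    integration over the normal variable. The term in 1/g only occurs in part
    (i), which assumes 1 < a. *)
Lemma noise_moment_bound (h : R -> R -> R) (al be ga : R) :
  measurable_fun setT (fun u : R * R => h u.1 u.2) ->
  (forall z g, 0 <= h z g) ->
  0 <= al -> 0 <= be -> 0 <= ga -> (ga = 0 \/ 1 < a) ->
  (forall g, 0 < g -> (\int[distribution P (Z 0)]_z (h z g)%:E <=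
     (al + be * g + ga / g)%:E)%E) ->
  (\int[distribution P (noise 0)]_u (h u.1 (pos_or_one u.2))%:E <=
   (al + be * a + ga / (a - 1))%:E)%E.
Proof.
move=> mh h0 al0 be0 ga0 gaa hb.
have mpos := @measurable_pos_or_one R.
have mhp : measurable_fun setT (fun u : R * R => h u.1 (pos_or_one u.2)).
  have mu1 : measurable_fun setT (fun u : R * R => (u.1, pos_or_one u.2)).
    apply: measurable_fun_pair; first exact: measurable_fst.
    by apply: measurableT_comp => //; exact: measurable_snd.
  exact: (measurableT_comp mh mu1).
rewrite (@integral_noise (fun z g => h z (pos_or_one g)))//.
have minv : measurable_fun setT (fun g : R => (pos_or_one g)^-1).
  by apply: measurableT_comp mpos; exact: measurable_inv.
have ig0 (g : R) : 0 <= (pos_or_one g)^-1.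
  by rewrite invr_ge0 ltW// pos_or_one_gt0.
have g0 (g : R) : 0 <= pos_or_one g by rewrite ltW// pos_or_one_gt0.
apply: (@le_trans _ _ (\int[distribution P (G 0)]_g
  (al%:E + be%:E * (pos_or_one g)%:E + ga%:E * ((pos_or_one g)^-1)%:E))%E).
  apply: le_integral_upper => [g||g].
  - by apply: integral_ge0 => z _; rewrite lee_fin.
  - apply: emeasurable_funD; first apply: emeasurable_funD => //.
      by apply: emeasurable_funM => //; exact/measurable_EFinP.
    by apply: emeasurable_funM => //; exact/measurable_EFinP.
  - by rewrite -!EFinM -!EFinD; apply: hb; exact: pos_or_one_gt0.
rewrite ge0_integralD//; last 4 first.
- by move=> g _; rewrite -EFinM -EFinD lee_fin addr_ge0// mulr_ge0.
- apply: emeasurable_funD => //.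
  by apply: emeasurable_funM => //; exact/measurable_EFinP.
- by move=> g _; rewrite -EFinM lee_fin mulr_ge0.
- by apply: emeasurable_funM => //; exact/measurable_EFinP.
rewrite ge0_integralD//; last 2 first.
- by move=> g _; rewrite -EFinM lee_fin mulr_ge0.
- by apply: emeasurable_funM => //; exact/measurable_EFinP.
rewrite integral_cst// [X in (_ * X + _ + _)%E](_ : _ = 1%E);
  last exact: probability_setT.
rewrite mule1 !EFinD.
apply: leeD; first apply: leeD => //.
- rewrite ge0_integralZl//; last 2 first.
  + exact/measurable_EFinP.
  + by move=> g _; rewrite lee_fin.
  rewrite EFinM; apply: lee_wpmul2l; first by rewrite lee_fin.
  exact: (gamma_law_mean a_gt0 (G_law 0)).
- case: gaa => [->|a1].
    rewrite mul0r; under eq_integral do rewrite mul0e.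
    by rewrite integral0.
  rewrite ge0_integralZl//; last 2 first.
  + exact/measurable_EFinP.
  + by move=> g _; rewrite lee_fin.
  rewrite EFinM; apply: lee_wpmul2l; first by rewrite lee_fin.
  exact: (gamma_law_inv_mean (G_law 0) a1).
Qed.

(** The exceptional set where some [G i] is nonpositive is negligible; there
    the local Lipschitz constant is bounded by infinity, and elsewhere by the
    product of derivatives, for which [drift_iterate] gives the bound. *)
Lemma gibbs_drift_function (phi : R -> R) (r : R) :
  measurable_fun setT phi -> 0 < r < 1 -> (forall x, 0 < x -> 1 <= phi x) ->
  (forall y, 0 < y -> (\int[distribution P (noise 0)]_u
     (gibbs_step_slope Y beta K u y * phi (gibbs_step Y beta K u y))%:E <=
     (r * phi y)%:E)%E) ->
  drift_function P (fun i w => gibbs_map Y beta K (Z i w) (G i w)) phi r.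
Proof.
move=> mphi r01 phi1 step; split=> // x n x0 _.
have r0 : 0 <= r by case/andP: r01 => /ltW.
pose D w := chain_deriv (gibbs_step Y beta K) (gibbs_step_slope Y beta K) noise n w x.
have D0 w : 0 <= D w.
  rewrite /D; elim: n x {x0 D} => [|k IH] x //=.
  by rewrite mulr_ge0// gibbs_slope_ge0.
have mD : measurable_fun setT D.
  apply: (@measurable_chain_deriv _ _ _ _ _ noise _ _
    (measurable_gibbs_step Y beta K) (measurable_gibbs_step_slope Y beta K) n (cst x)).
  exact: measurable_cst.
have q0 u y : 0 < y -> 0 < gibbs_step Y beta K u y.
  by move=> y0; apply: gibbs_map_gt0 => //; exact: pos_or_one_gt0.
have main := @drift_iterate _ _ _ _ _ P noise (distribution P (noise 0))
  (gibbs_step Y beta K) (gibbs_step_slope Y beta K) phi r pairs_indep noise_law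
  (measurable_gibbs_step Y beta K) (measurable_gibbs_step_slope Y beta K) mphi q0
  (fun u y => gibbs_slope_ge0 _ _ _ _ _ _) phi1 r0 step n x x0.
pose N := \bigcup_i (G i @^-1` `]-oo, 0%R]%classic).
have mGi i : measurable (G i @^-1` `]-oo, 0%R]%classic).
  by apply: measurable_funPTI; exact: measurable_itv.
have mN : measurable N by exact: bigcupT_measurable.
have PN : P N = 0%E.
  apply: measure_negligible => //; apply: negligible_bigcup => i.
  exists (G i @^-1` `]-oo, 0%R]%classic); split=> //.
  exact: (gamma_law_nonpos (G_law i)).
(* A measurable upper bound, infinite on [N] and equal to [D] elsewhere. *)
pose h w := ((D w)%:E + +oo * (\1_N w)%:E)%E.
have mh1 : measurable_fun setT (fun w => +oo * (\1_N w)%:E : \bar R)%E.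
  by apply: emeasurable_funM => //; apply/measurable_EFinP.
have le_h w : (local_lip (iter_comp
    (fun i => gibbs_map Y beta K (Z i w) (G i w)) n) x <= h w)%E.
  rewrite /h indicE; case: (boolP (w \in N)) => wN.
    by rewrite mule1 addey ?leey// gt_eqF// (lt_le_trans (ltNyr 0))// lee_fin.
  rewrite mule0 adde0.
  have G0 i : 0 < G i w.
    rewrite ltNge; apply/negP => Gi; move/negP: wN; apply.
    by rewrite inE; exists i => //=; rewrite in_itv.
  have [dg hdg dgE] := @is_derive_iter_comp R J Y beta K hJ hK hS T Z G w n x x0 G0.
  by rewrite (le_trans (local_lip_le hdg))// dgE.
apply: (@le_trans _ _ (\int[P]_w h w)%E).
  apply: le_integral_upper => [w||w]; [exact: local_lip_ge0| |exact: le_h].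
  by apply: emeasurable_funD => //; exact/measurable_EFinP.
rewrite ge0_integralD//; last 2 first.
- by move=> w _; rewrite lee_fin.
- exact/measurable_EFinP.
rewrite ge0_integralZl//; last exact/measurable_EFinP.
rewrite integral_indic// setIT [X in (_ + +oo * X)%E](_ : _ = 0%E);
  last exact: PN.
by rewrite mule0 adde0.
Qed.
End gibbs_drift.

(** * The three drift functions *)

Lemma normal_law_quadratic_le (R : realType) (nu : probability R R)
    (f : R -> R) (k C : R) :
  (forall A : set R, measurable A -> nu A = normal_prob 0 1 A) ->
  0 <= k -> 0 <= C -> (forall z, 0 <= f z) ->
  (forall z, f z <= (`|z| + k) * (`|z| / 2 + k) * C) ->
  (\int[nu]_z (f z)%:E <= ((k + 1) * (k + 1 / 2) * C)%:E)%E.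
Proof.
move=> nuE k0 C0 f0 fQ.
have Q0 (z : R) : 0 <= (`|z| + k) * (`|z| / 2 + k).
  by rewrite mulr_ge0 ?addr_ge0 ?divr_ge0.
have mQ : measurable_fun setT (fun z : R => ((`|z| + k) * (`|z| / 2 + k))%:E).
  apply/measurable_EFinP; apply: measurable_funM; apply: measurable_funD => //.
  by apply: measurable_funM => //; exact: measurableT_comp.
apply: (@le_trans _ _ (\int[nu]_z
    (C%:E * ((`|z| + k) * (`|z| / 2 + k))%:E))%E).
  apply: le_integral_upper => [z||z].
  - by rewrite lee_fin.
  - exact: emeasurable_funM.
  - by rewrite -EFinM lee_fin mulrC.
rewrite ge0_integralZl//; last by move=> z _; rewrite lee_fin.
rewrite [((k + 1) * _ * C)%R]mulrC EFinM; apply: lee_wpmul2l.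
  by rewrite lee_fin.
exact: normal_law_quadratic.
Qed.

Section drift_rates.
Context (R : realType) (J : nat) (Y : 'I_J -> R) (beta K a : R).
Hypotheses (hJ : (1 <= J)%N) (hK : 0 <= K) (hS : 0 < Sigma0 Y beta)
  (a_gt0 : 0 < a).
Context (d : measure_display) (T : measurableType d) (P : probability T R)
  (Z G : nat -> {RV P >-> R}).
Hypotheses
  (Z_law : forall (i : nat) (A : set R), measurable A ->
     distribution P (Z i) A = normal_prob 0 1 A)
  (G_law : forall (i : nat) (A : set R), measurable A ->
     distribution P (G i) A = gamma_prob a A)
  (ZG_indep : forall i : nat, independent_rv2 P (Z i) (G i))
  (pairs_indep : independent_seq P (fun i w => (Z i w, G i w))).
Let j : R := J%:R.
Let S0 := Sigma0 Y beta.
Let m := `|sample_mean Y|.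
Let j0 : 0 < j. Proof. by rewrite ltr0n. Qed.
Let m0 : 0 <= m. Proof. exact: normr_ge0. Qed.
Let nuZ := distribution P (Z 0).

Lemma integral_gibbs_slope_le (k g s : R) : 0 < s -> 0 < g ->
  m * K / Num.sqrt (s * j + K) <= k ->
  (\int[nuZ]_z (gibbs_slope Y beta K z g s)%:E <=
   ((k + 1) * (k + 1 / 2) * (g * j ^+ 2 / (S0 ^+ 2 * (s * j + K) ^+ 2)))%:E)%E.
Proof.
move=> s0 g0 hk; apply: normal_law_quadratic_le.
- exact: Z_law.
- by apply: le_trans hk; rewrite !mulr_ge0// invr_ge0.
- by apply: divr_ge0; apply: mulr_ge0; rewrite ?sqr_ge0 ?(ltW g0).
- by move=> z; exact: gibbs_slope_ge0.
- by move=> z; exact: gibbs_slope_le.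
Qed.

Lemma measurable_gibbs_integrand (s : R) (phi : R -> R) :
  measurable_fun setT phi ->
  measurable_fun setT (fun u : R * R => gibbs_slope Y beta K u.1 u.2 s
    * phi (gibbs_map Y beta K u.1 u.2 s)).
Proof.
move=> mphi; apply: measurable_funM.
  apply: measurable_gibbs_slope => //.
apply: (measurableT_comp mphi).
apply: measurable_gibbs_map => //.
Qed.

Lemma drift_of_noise_bound (phi al be ga : R -> R) (r : R) :
  measurable_fun setT phi -> 0 < r < 1 -> (forall x, 0 <= phi x) ->
  (forall x, 0 < x -> 1 <= phi x) ->
  (forall y, 0 < y -> [/\ 0 <= al y, 0 <= be y, 0 <= ga y,
     ga y = 0 \/ 1 < a & al y + be y * a + ga y / (a - 1) <= r * phi y]) ->
  (forall y g, 0 < y -> 0 < g ->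
     (\int[nuZ]_z (gibbs_slope Y beta K z g y
        * phi (gibbs_map Y beta K z g y))%:E <=
      (al y + be y * g + ga y / g)%:E)%E) ->
  drift_function P (fun i w => gibbs_map Y beta K (Z i w) (G i w)) phi r.
Proof.
move=> mphi r01 phi0 phi1 coef bound.
apply: (gibbs_drift_function hJ hK hS Z_law G_law ZG_indep pairs_indep)
  => // y y0.
have [al0 be0 ga0 gaa le_r] := coef y y0.
apply: (@le_trans _ _ (al y + be y * a + ga y / (a - 1))%:E);
  last by rewrite lee_fin.
apply: (@noise_moment_bound _ _ a_gt0 _ _ P Z G G_law ZG_indep
  (fun z g => gibbs_slope Y beta K z g y * phi (gibbs_map Y beta K z g y)))
  => //.
- exact: measurable_gibbs_integrand.
- by move=> z g; rewrite mulr_ge0// gibbs_slope_ge0.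
- by move=> g g0; exact: bound.
Qed.

(** From max(eps, 1/q^2) <= eps + 1/q^2, with q the new position, the two
    estimates for |f'| and |f'|/q^2 add up, both being of order J^2 / (y J +
    K)^2 <= 1 / y^2. *)
Lemma gibbs_drift_inverse_square (eps : R) :
  let A := a * (m * Num.sqrt K + 1) * (m * Num.sqrt K + 1 / 2) / S0 ^+ 2 in
  let r1 := (m * Num.sqrt K + 1) * (m * Num.sqrt K + 1 / 2) / (a - 1) in
  1 < a -> 0 < eps -> r1 + eps * A < 1 ->
  drift_function P (fun i w => gibbs_map Y beta K (Z i w) (G i w))
    (fun x => 1 / eps * Num.max eps (1 / x ^+ 2)) (r1 + eps * A).
Proof.
move=> A r1 a1 e0 r_lt1.
pose k := m * Num.sqrt K.
have k0 : 0 <= k by rewrite mulr_ge0.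
pose B := (k + 1) * (k + 1 / 2).
have B0 : 0 < B.
  by rewrite /B; move: (k) k0 => k' k0; nra.
have AE : A = B * a / S0 ^+ 2.
  by rewrite /A /B -/k; move: (k) (S0 ^+ 2) => ? ?; ring.
have r1E : r1 = B / (a - 1) by [].
have S20 : 0 < S0 ^+ 2 by rewrite exprn_gt0.
have a10 : 0 < a - 1 by rewrite subr_gt0.
pose phi (x : R) := 1 / eps * Num.max eps (1 / x ^+ 2).
have ie0 : 0 <= 1 / eps by rewrite divr_ge0// ltW.
have mphi : measurable_fun setT phi.
  apply: measurable_funM => //; apply: measurable_maxr => //.
  by apply: measurable_div_comp => //; exact: measurable_funX.
have phi_ge1 x : 1 <= phi x.
  rewrite -[leLHS](_ : 1 / eps * eps = 1); last by field; rewrite gt_eqF.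
  by rewrite ler_wpM2l// le_max lexx.
have r0 : 0 < r1 + eps * A.
  by rewrite addr_gt0 ?r1E ?AE ?divr_gt0// mulr_gt0// divr_gt0// mulr_gt0.
pose tau (y : R) := j ^+ 2 / (y * j + K) ^+ 2.
have tau0 y : 0 <= tau y by rewrite divr_ge0 ?sqr_ge0.
apply: (@drift_of_noise_bound phi (fun=> 0) (fun y => B / S0 ^+ 2 * tau y)
  (fun y => B / eps * tau y)) => //.
- by rewrite r0.
- by move=> x; exact: le_trans ler01 (phi_ge1 x).
- move=> y y0; have t0 : 0 < y * j + K by exact: sjK_gt0.
  have c1 : 0 <= B / S0 ^+ 2 by rewrite ltW ?divr_gt0.
  have c2 : 0 <= B / eps by rewrite ltW ?divr_gt0.
  split=> //; [exact: mulr_ge0|exact: mulr_ge0|by right|].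
  have tau_le : tau y <= 1 / y ^+ 2.
    rewrite /tau ler_pdivrMr ?exprn_gt0// mulrAC ler_pdivlMr ?exprn_gt0// mul1r.
    rewrite -exprMn ler_pXn2r ?nnegrE ?mulr_ge0 ?(ltW y0) ?(ltW j0) ?(ltW t0)//.
    by rewrite mulrC lerDl.
  have phi_ge : 1 / eps * (1 / y ^+ 2) <= phi y.
    by rewrite /phi ler_wpM2l// le_max lexx orbT.
  rewrite /= add0r [leLHS](_ : _ = (r1 + eps * A) * (1 / eps * tau y));
    last first.
    by rewrite r1E AE; move: (tau y) => ?; field; rewrite !gt_eqF.
  rewrite ler_wpM2l ?(ltW r0)//; apply: le_trans phi_ge.
  by rewrite ler_wpM2l.
- move=> y g y0 g0; have t0 : 0 < y * j + K by exact: sjK_gt0.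
  have kt : m * K / Num.sqrt (y * j + K) <= k.
    rewrite ler_pdivrMr ?sqrtr_gt0// /k -mulrA ler_wpM2l//.
    rewrite -{1}(sqr_sqrtr hK) expr2 ler_wpM2l// ler_wsqrtr// lerDr.
    by rewrite mulr_ge0 ?ltW.
  rewrite add0r (_ : _ + _ = (k + 1) * (k + 1 / 2) *
    (g * j ^+ 2 / (S0 ^+ 2 * (y * j + K) ^+ 2) +
     1 / eps * (j ^+ 2 / ((y * j + K) ^+ 2 * g)))); last first.
    by rewrite /B /tau; field; rewrite !gt_eqF.
  apply: normal_law_quadratic_le => //.
  + exact: Z_law.
  + apply: addr_ge0; first by apply: divr_ge0;
      apply: mulr_ge0; rewrite ?sqr_ge0 ?(ltW g0).
    apply: mulr_ge0 => //; apply: divr_ge0; first exact: sqr_ge0.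
    by rewrite mulr_ge0 ?sqr_ge0 ?(ltW g0).
  + move=> z; rewrite mulr_ge0 ?gibbs_slope_ge0//.
    exact: le_trans ler01 (phi_ge1 _).
  move=> z; rewrite mulrDr.
  have h1 := gibbs_slope_le hJ hK hS z y0 g0 kt.
  have h2 := gibbs_slope_div_sq_le hJ hK hS z y0 g0 kt.
  have sl0 := gibbs_slope_ge0 Y beta K z g y.
  apply: (@le_trans _ _ (gibbs_slope Y beta K z g y + 1 / eps *
     (gibbs_slope Y beta K z g y / gibbs_map Y beta K z g y ^+ 2))).
    rewrite (_ : _ + _ = gibbs_slope Y beta K z g y *
       (1 / eps * (eps + 1 / gibbs_map Y beta K z g y ^+ 2))); last first.
      by rewrite mulrDr mulrDr div1r mulVf ?gt_eqF// mulr1 mul1r mulrCA.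
    rewrite ler_wpM2l// ler_wpM2l// ge_max lerDl lerDr (ltW e0) andbT.
    by rewrite divr_ge0 ?sqr_ge0.
  by apply: lerD => //; rewrite [leRHS]mulrCA; exact: ler_wpM2l.
Qed.

(** For K = 1 the factor 1 / (y J + K)^2 is at most 1. *)
Lemma gibbs_drift_constant : K = 1 ->
  let r2 := a * (j ^+ 2 / S0 ^+ 2) * (m + 1) * (m + 1 / 2) in
  r2 < 1 ->
  drift_function P (fun i w => gibbs_map Y beta K (Z i w) (G i w))
    (fun=> 1) r2.
Proof.
move=> K1 r2 r_lt1.
have S20 : 0 < S0 ^+ 2 by rewrite exprn_gt0.
have r0 : 0 < r2.
  rewrite /r2 !mulr_gt0// ?invr_gt0// ?exprn_gt0//; last by rewrite ltr_wpDl.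
  by rewrite ltr_wpDl.
pose B := (m + 1) * (m + 1 / 2) * j ^+ 2 / S0 ^+ 2.
have B0 : 0 <= B.
  apply: divr_ge0; last exact: ltW.
  apply: mulr_ge0; last exact: sqr_ge0.
  by apply: mulr_ge0; rewrite addr_ge0.
apply: (@drift_of_noise_bound (fun=> 1) (fun=> 0) (fun=> B) (fun=> 0)) => //.
- by rewrite r0.
- move=> y y0; split=> //; first by left.
  rewrite add0r mul0r addr0 mulr1 le_eqVlt; apply/orP; left; apply/eqP.
  by rewrite /B /r2; field; rewrite !gt_eqF.
move=> y g y0 g0; have t0 : 0 < y * j + K by exact: sjK_gt0.
have t1 : 1 <= y * j + K by rewrite K1 lerDr mulr_ge0 ?ltW.
have kt : m * K / Num.sqrt (y * j + K) <= m.
  rewrite {1}K1 mulr1 ler_pdivrMr ?sqrtr_gt0// ler_peMr//.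
  by rewrite -[leLHS]sqrtr1 ler_wsqrtr.
under eq_integral do rewrite mulr1.
apply: le_trans (integral_gibbs_slope_le y0 g0 kt) _.
rewrite lee_fin add0r mul0r addr0.
rewrite (_ : B * g = (m + 1) * (m + 1 / 2) * (g * j ^+ 2 / S0 ^+ 2)); last first.
  by rewrite /B; field; rewrite !gt_eqF.
apply: ler_wpM2l; first by rewrite mulr_ge0 ?addr_ge0.
apply: ler_wpM2l; first by rewrite mulr_ge0 ?sqr_ge0 ?(ltW g0).
rewrite lef_pV2 ?posrE ?mulr_gt0 ?exprn_gt0// ler_peMr ?(ltW S20)//.
by rewrite exprn_ege1.
Qed.

(** From max(eps, b(q)) <= eps + b(q). The first term is at most Ahat b(y)
    after integration; the second one contributes r3 b(y) by
    [gibbs_potential_bound]. *)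
Lemma gibbs_drift_weight (eps : R) : K = 1 ->
  let Ahat := (m + 1) * a * j * Num.sqrt (2 * pi) / (2 * S0 ^+ 2) in
  let r3 := potential j m (a / S0) in
  0 < eps -> r3 + eps * Ahat < 1 ->
  drift_function P (fun i w => gibbs_map Y beta K (Z i w) (G i w))
    (fun x => 1 / eps * Num.max eps (weight j m x)) (r3 + eps * Ahat).
Proof.
move=> K1 Ahat r3 e0 r_lt1.
have S20 : 0 < S0 ^+ 2 by rewrite exprn_gt0.
have p0 : 0 < Num.sqrt (2 * pi) :> R by exact: sqrt2pi_gt0.
have aS0 : 0 <= a / S0 by rewrite divr_ge0// ltW.
have A0 : 0 < Ahat.
  by rewrite divr_gt0 ?mulr_gt0// ltr_wpDl.
have r30 : 0 <= r3 by exact: potential_ge0.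
have r0 : 0 < r3 + eps * Ahat by rewrite ltr_wpDl// mulr_gt0.
have ie0 : 0 <= 1 / eps by rewrite divr_ge0// ltW.
pose phi (x : R) := 1 / eps * Num.max eps (weight j m x).
have mphi : measurable_fun setT phi.
  apply: measurable_funM => //; apply: measurable_maxr => //.
  exact: measurable_weight.
have phi_ge1 x : 1 <= phi x.
  rewrite -[leLHS](_ : 1 / eps * eps = 1); last by field; rewrite gt_eqF.
  by rewrite ler_wpM2l// le_max lexx.
(* The affine majorant of the potential given by its tangent at the mean. *)
pose c1 := weight j m (a / S0) / S0.
pose c0 := r3 - weight j m (a / S0) * (a / S0).
have c1_ge0 : 0 <= c1 by rewrite divr_ge0 ?weight_ge0// ltW.
have c0_ge0 : 0 <= c0 by exact: potential_affine_bound.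
have potential_le g : 0 < g -> potential j m (g / S0) <= c0 + c1 * g.
  move=> g0; have gS : 0 <= g / S0 by rewrite divr_ge0// ltW.
  apply: le_trans (potential_tangent j0 m0 aS0 gS) _.
  rewrite -/r3 /c0 /c1 le_eqVlt; apply/orP; left; apply/eqP.
  by field; rewrite gt_eqF.
pose be (y : R) := (m / Num.sqrt (y * j + 1) + 1) *
  (m / Num.sqrt (y * j + 1) + 1 / 2) *
  (j ^+ 2 / (S0 ^+ 2 * (y * j + 1) ^+ 2)).
apply: (@drift_of_noise_bound phi (fun y => 1 / eps * weight j m y * c0)
  (fun y => be y + 1 / eps * weight j m y * c1) (fun=> 0)) => //.
- by rewrite r0.
- by move=> x; exact: le_trans ler01 (phi_ge1 x).
- move=> y y0; have t0 : 0 < y * j + 1 by apply: affine_gt0 => //; exact: ltW.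
  have wt0 : 0 <= weight j m y by apply: weight_ge0 => //; exact: ltW.
  have w0 : 0 < Num.sqrt (y * j + 1) by rewrite sqrtr_gt0.
  have be0 : 0 <= be y.
    rewrite /be; apply: mulr_ge0; first apply: mulr_ge0.
    + by rewrite addr_ge0// divr_ge0.
    + by rewrite addr_ge0// divr_ge0.
    by apply: divr_ge0; [|apply: mulr_ge0]; exact: sqr_ge0.
  have iw0 : 0 <= 1 / eps * weight j m y := mulr_ge0 ie0 wt0.
  split=> //.
  + exact: mulr_ge0 iw0 c0_ge0.
  + exact: addr_ge0 be0 (mulr_ge0 iw0 c1_ge0).
  + by left.
  have w1 : 1 <= Num.sqrt (y * j + 1).
    by rewrite -[leLHS]sqrtr1 ler_wsqrtr// lerDr mulr_ge0 ?ltW.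
  have be_le : be y * a <= Ahat * weight j m y.
    rewrite /be weightE ?(ltW y0)// /Ahat.
    have tE : y * j + 1 = Num.sqrt (y * j + 1) ^+ 2 by rewrite sqr_sqrtr// ltW.
    move: (Num.sqrt (y * j + 1)) (Num.sqrt (2 * pi)) p0 w0 w1 tE
      => w p p0 w0 w1 ->.
    pose E := a * j ^+ 2 * (m / w + 1 / 2) / (S0 ^+ 2 * w ^+ 2).
    have E0 : 0 <= E.
      apply: divr_ge0; last by rewrite mulr_ge0 ?sqr_ge0 ?(ltW S20).
      apply: mulr_ge0; first by rewrite mulr_ge0 ?sqr_ge0// ltW.
      by rewrite addr_ge0// divr_ge0// ltW.
    rewrite [leLHS](_ : _ = E * ((m / w + 1) / w ^+ 2)); last first.
      by rewrite /E; field; rewrite !gt_eqF.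
    rewrite [leRHS](_ : _ = E * (m + 1)); last first.
      by rewrite /E; field; rewrite !gt_eqF.
    apply: ler_wpM2l => //.
    rewrite ler_pdivrMr ?exprn_gt0//.
    apply: (@le_trans _ _ (m + 1)).
      by rewrite lerD2r ler_pdivrMr// ler_peMr.
    by rewrite ler_peMr ?addr_ge0// exprn_ege1.
  have phi_ge : 1 / eps * weight j m y <= phi y.
    by rewrite /phi ler_wpM2l// le_max lexx orbT.
  rewrite /= mul0r addr0.
  apply: (@le_trans _ _ ((r3 + eps * Ahat) * (1 / eps * weight j m y)));
    last by rewrite ler_wpM2l ?(ltW r0).
  rewrite [leLHS](_ : _ = be y * a + 1 / eps * weight j m y * r3); last first.
    by rewrite /c0 /c1; field; rewrite !gt_eqF.
  rewrite [leRHS](_ : _ = Ahat * weight j m y + 1 / eps * weight j m y * r3).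
    by rewrite lerD2r.
  by field; rewrite gt_eqF.
move=> y g y0 g0.
have t0 : 0 < y * j + 1 by apply: affine_gt0 => //; exact: ltW.
have wt0 : 0 <= weight j m y by apply: weight_ge0 => //; exact: ltW.
have slope_le := @integral_gibbs_slope_le (m / Num.sqrt (y * j + 1)) g y y0 g0.
rewrite K1 mulr1 in slope_le; have {}slope_le := slope_le (lexx _).
have weight_le := gibbs_potential_bound hJ hS (Z_law 0) y0 g0.
have gq0 z : 0 < gibbs_map Y beta 1 z g y by exact: gibbs_map_gt0.
have msl : measurable_fun setT (fun z : R => gibbs_slope Y beta 1 z g y).
  exact: measurable_gibbs_slope.
have mslw : measurable_fun setT (fun z : R => gibbs_slope Y beta 1 z g y *
    weight j m (gibbs_map Y beta 1 z g y)).
  apply: measurable_funM => //.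
  apply: measurableT_comp; first exact: measurable_weight.
  exact: measurable_gibbs_map.
have slw0 z : 0 <= gibbs_slope Y beta 1 z g y *
    weight j m (gibbs_map Y beta 1 z g y).
  apply: mulr_ge0; first exact: gibbs_slope_ge0.
  by apply: weight_ge0 => //; exact: ltW.
rewrite K1.
apply: (@le_trans _ _ (\int[nuZ]_z ((gibbs_slope Y beta 1 z g y)%:E +
  (1 / eps)%:E * (gibbs_slope Y beta 1 z g y *
    weight j m (gibbs_map Y beta 1 z g y))%:E))%E).
  apply: le_integral_upper => [z||z].
  - rewrite lee_fin mulr_ge0 ?gibbs_slope_ge0//.
    exact: le_trans ler01 (phi_ge1 _).
  - apply: emeasurable_funD; first exact/measurable_EFinP.
    by apply: emeasurable_funM => //; exact/measurable_EFinP.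
  - rewrite -EFinM -EFinD lee_fin.
    rewrite [leRHS](_ : _ = gibbs_slope Y beta 1 z g y *
      (1 / eps * (eps + weight j m (gibbs_map Y beta 1 z g y)))); last first.
      by field; rewrite gt_eqF.
    rewrite ler_wpM2l ?gibbs_slope_ge0// ler_wpM2l//.
    rewrite ge_max lerDl lerDr (ltW e0) andbT.
    by apply: weight_ge0 => //; exact: ltW.
rewrite ge0_integralD//; last 4 first.
- by move=> z _; rewrite lee_fin gibbs_slope_ge0.
- exact/measurable_EFinP.
- by move=> z _; rewrite mule_ge0 ?lee_fin.
- by apply: emeasurable_funM => //; exact/measurable_EFinP.
rewrite ge0_integralZl//; last 2 first.
- exact/measurable_EFinP.
- by move=> z _; rewrite lee_fin.
have ieE : (0 <= (1 / eps)%:E)%E by rewrite lee_fin.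
apply: (le_trans (leeD slope_le (lee_wpmul2l ieE weight_le))).
rewrite -EFinM -EFinD lee_fin mul0r addr0.
apply: (@le_trans _ _ (be y * g + 1 / eps * weight j m y * (c0 + c1 * g))).
  apply: lerD.
    by rewrite /be le_eqVlt; apply/orP; left; apply/eqP; ring.
  by rewrite mulrA ler_wpM2l ?(mulr_ge0 ie0 wt0)// potential_le.
by rewrite le_eqVlt; apply/orP; left; apply/eqP; ring.
Qed.
End drift_rates.

Theorem proposition10 (R : realType) (J : nat) (hJ : (1 <= J)%N)
  (Y : 'I_J -> R) (alpha beta K : R)
  (halpha : 0 < alpha) (hbeta : 0 <= beta) (hK : 0 <= K)
  (hSigma0 : 0 < Sigma0 Y beta)
  (d : measure_display) (T : measurableType d) (P : probability T R)
  (Z G : nat -> {RV P >-> R})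
  (Z_law : forall (i : nat) (A : set R), measurable A ->
     distribution P (Z i) A = normal_prob 0 1 A)
  (G_law : forall (i : nat) (A : set R), measurable A ->
     distribution P (G i) A = gamma_prob (alpha + J%:R / 2) A)
  (ZG_indep : forall i : nat, independent_rv2 P (Z i) (G i))
  (pairs_indep : independent_seq P (fun i w => (Z i w, G i w))) :
  let f := fun (i : nat) (w : T) => gibbs_map Y beta K (Z i w) (G i w) in
  let a := alpha + J%:R / 2 in
  let S0 := Sigma0 Y beta in
  let m := `|sample_mean Y| in
  [/\ (* (i) *)
      (let A := a * (m * Num.sqrt K + 1) * (m * Num.sqrt K + 1 / 2) / S0 ^+ 2 in
       let r1 := (m * Num.sqrt K + 1) * (m * Num.sqrt K + 1 / 2) / (a - 1) in
       1 < a -> r1 < 1 ->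
       forall eps : R, 0 < eps -> r1 + eps * A < 1 ->
         drift_function P f
           (fun x => 1 / eps * Num.max eps (1 / x ^+ 2)) (r1 + eps * A)),
      (* (ii) *)
      (K = 1 ->
       let r2 := a * (J%:R ^+ 2 / S0 ^+ 2) * (m + 1) * (m + 1 / 2) in
       r2 < 1 -> drift_function P f (fun _ => 1) r2) &
      (* (iii) *)
      (K = 1 ->
       let Ahat := (m + 1) * a * J%:R * Num.sqrt (2 * pi) / (2 * S0 ^+ 2) in
       let b := fun x : R => J%:R / Num.sqrt (2 * pi) *
         (2 * m / (x * J%:R + 1) `^ (3 / 2) + 1 / (x * J%:R + 1)) in
       let r3 := 1 / Num.sqrt (2 * pi) *
         (4 * m * (1 - 1 / Num.sqrt (J%:R * a / S0 + 1))
          + ln (J%:R * a / S0 + 1)) in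
       r3 < 1 ->
       forall eps : R, 0 < eps -> r3 + eps * Ahat < 1 ->
         drift_function P f
           (fun x => 1 / eps * Num.max eps (b x)) (r3 + eps * Ahat))].
Proof.
move=> f a S0 m.
have a_gt0 : 0 < a by rewrite /a ltr_wpDr// divr_ge0.
split.
- move=> A r1 a1 _ eps eps0 r_lt1.
  exact: (@gibbs_drift_inverse_square _ _ Y beta K a hJ hK hSigma0 a_gt0 _ _ P
    Z G Z_law G_law ZG_indep pairs_indep eps a1 eps0 r_lt1).
- move=> K1 r2 r_lt1.
  exact: (@gibbs_drift_constant _ _ Y beta K a hJ hK hSigma0 a_gt0 _ _ P
    Z G Z_law G_law ZG_indep pairs_indep K1 r_lt1).
- move=> K1 Ahat b r3 _ eps eps0 r_lt1.
  have r3E : r3 = potential J%:R m (a / S0).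
    by rewrite /potential (_ : a / S0 * J%:R = J%:R * a / S0)// mulrC mulrA.
  rewrite r3E in r_lt1 *.
  exact: (@gibbs_drift_weight _ _ Y beta K a hJ hK hSigma0 a_gt0 _ _ P
    Z G Z_law G_law ZG_indep pairs_indep eps K1 eps0 r_lt1).
Qed.
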